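(* Let $\alpha,\beta\in\mathbb{C}$, $p\in\mathbb{C}^*$, and let $V$ be a non-trivial finite irreducible conformal module over the Lie conformal algebra $\mathfrak{B}(\alpha,\beta,p)$. (1) Suppose $p\neq-1$. (i) If $(\alpha,\beta)\neq(p,0)$, then $V\cong V_{a,b}$ for some $a\in\mathbb{C}^*$, $b\in\mathbb{C}$. (ii) If $(\alpha,\beta)=(p,0)$, then $V\cong V_{a,b,d}$ for some $a,b,d\in\mathbb{C}$ with $a\in\mathbb{C}^*$ or $d\in\mathbb{C}^*$. (2) Suppose $p=-1$. (iii) If $(\alpha,\beta)\neq(-1,0)$, then $V\cong V_{a,b,c}$ for some $a,b,c\in\mathbb{C}$ with $a\in\mathbb{C}^*$ or $c\in\mathbb{C}^*$. (iv) If $(\alpha,\beta)=(-1,0)$, then $V\cong V_{a,b,c,d}$ for some $a,b,c,d\in\mathbb{C}$ with $a\in\mathbb{C}^*$ or $c\in\mathbb{C}^*$ or $d\in\mathbb{C}^*$.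
   Context: All vector spaces are over $\mathbb{C}$; $\mathbb{C}^*=\mathbb{C}\setminus\{0\}$, $\mathbb{Z}_+=\{0,1,2,\dots\}$. A Lie conformal algebra is a $\mathbb{C}[\partial]$-module $R$ with a linear map $R\otimes R\to R[\lambda]=\mathbb{C}[\lambda]\otimes R$, $a\otimes b\mapsto[a\,{}_\lambda\,b]$, such that $[\partial a\,{}_\lambda\,b]=-\lambda[a\,{}_\lambda\,b]$, $[a\,{}_\lambda\,\partial b]=(\partial+\lambda)[a\,{}_\lambda\,b]$, $[a\,{}_\lambda\,b]=-[b\,{}_{-\lambda-\partial}\,a]$, and $[a\,{}_\lambda[b\,{}_\mu\,c]]=[[a\,{}_\lambda\,b]\,{}_{\lambda+\mu}\,c]+[b\,{}_\mu[a\,{}_\lambda\,c]]$. A conformal module over $R$ is a $\mathbb{C}[\partial]$-module $M$ with a linear map $R\otimes M\to M[\lambda]$, $a\otimes v\mapsto a\,{}_\lambda\,v$, such that $(\partial a)\,{}_\lambda\,v=-\lambda\, a\,{}_\lambda\,v$, $a\,{}_\lambda(\partial v)=(\partial+\lambda)\,a\,{}_\lambda\,v$, $a\,{}_\lambda(b\,{}_\mu\,v)-b\,{}_\mu(a\,{}_\lambda\,v)=[a\,{}_\lambda\,b]\,{}_{\lambda+\mu}\,v$. It is finite if finitely generated over $\mathbb{C}[\partial]$, non-trivial if the $\lambda$-action is not identically zero, and irreducible if it is nonzero and has no submodules other than $0$ and itself. For $\alpha,\beta\in\mathbb{C}$, $p\in\mathbb{C}^*$, $\mathfrak{B}(\alpha,\beta,p)$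 is the Lie conformal algebra that is free over $\mathbb{C}[\partial]$ with basis $\{L_i,W_i\mid i\in\mathbb{Z}_+\}$ and $\lambda$-brackets $[L_i\,{}_\lambda\,L_j]=\big((i+p)\partial+(i+j+2p)\lambda\big)L_{i+j}$, $[L_i\,{}_\lambda\,W_j]=\big((i+p)(\partial+\beta)+(i+j+\alpha)\lambda\big)W_{i+j}$, $[W_i\,{}_\lambda\,W_j]=0$ (with $[W_j\,{}_\lambda\,L_i]$ given by skew-symmetry). The following are conformal modules over $\mathfrak{B}(\alpha,\beta,p)$, each free of rank one over $\mathbb{C}[\partial]$ with generator $v$: - If $(\alpha,\beta)\neq(p,0)$, $a,b\in\mathbb{C}$: $V_{a,b}=\mathbb{C}[\partial]v$ with $L_0\,{}_\lambda\,v=p(\partial+a\lambda+b)v$, $W_0\,{}_\lambda\,v=0$, $L_i\,{}_\lambda\,v=W_i\,{}_\lambda\,v=0$ for $i\ge1$. - If $(\alpha,\beta)=(p,0)$, $a,b,d\in\mathbb{C}$: $V_{a,b,d}=\mathbb{C}[\partial]v$ with $L_0\,{}_\lambda\,v=p(\partial+a\lambda+b)v$, $W_0\,{}_\lambda\,v=dv$, $L_i\,{}_\lambda\,v=W_i\,{}_\lambda\,v=0$ for $i\ge1$. - If $p=-1$ and $(\alpha,\beta)\neq(-1,0)$, $a,b,c\in\mathbb{C}$: $V_{a,b,c}=\mathbb{C}[\partial]v$ with $L_0\,{}_\lambda\,v=-(\partial+a\lambda+b)v$, $L_1\,{}_\lambda\,v=cv$, $L_j\,{}_\lambda\,v=0$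 for $j\ge2$, $W_i\,{}_\lambda\,v=0$ for all $i\ge0$. - If $p=-1$ and $(\alpha,\beta)=(-1,0)$, $a,b,c,d\in\mathbb{C}$: $V_{a,b,c,d}=\mathbb{C}[\partial]v$ with $L_0\,{}_\lambda\,v=-(\partial+a\lambda+b)v$, $L_1\,{}_\lambda\,v=cv$, $L_j\,{}_\lambda\,v=0$ for $j\ge2$, $W_0\,{}_\lambda\,v=dv$, $W_i\,{}_\lambda\,v=0$ for $i\ge1$. *)

(* Defs.v *)
From HB Require Import structures.
From mathcomp Require Import all_boot all_order all_algebra.
From mathcomp Require Import zify ring.
From mathcomp Require Import reals complex.

Set Implicit Arguments.
Unset Strict Implicit.
Unset Printing Implicit Defensive.

Import GRing.Theory.
Local Open Scope ring_scope.

(* A C[D]-module (D stands for partial) is an lmodType over {poly F}, D acting as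
   'X. An element
   \sum_n lambda^n P_n of M[lambda] is encoded by its coefficient sequence
   P : nat -> M, required to vanish eventually wherever it occurs (lp_fin). All
   identities between polynomials in lambda (and mu) are stated coefficientwise. *)

(* Multiplication by lambda. *)
Definition lshift (F : fieldType) (M : lmodType {poly F}) (P : nat -> M) (n : nat) : M :=
  if n is k.+1 then P k else 0.

(* op a v is the coefficient sequence of a_lambda v; used both for the
   lambda-bracket (M = A) and for the lambda-action on a module. lp_linl and
   lp_linr are linearity over the constants F only. *)
Record lambda_product (F : fieldType) (A M : lmodType {poly F})
    (op : A -> M -> nat -> M) : Prop := LambdaProduct {
  lp_fin : forall a v, exists N, forall n, (N <= n)%N -> op a v n = 0;
  lp_linl : forall (c : F) a a' v n,
    op (c%:P *: a + a') v n = c%:P *: op a v n + op a' v n;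
  lp_linr : forall (c : F) a v v' n,
    op a (c%:P *: v + v') n = c%:P *: op a v n + op a v' n;
  lp_dl : forall a v n, op ('X *: a) v n = - lshift (op a v) n;
  lp_dr : forall a v n, op a ('X *: v) n = 'X *: op a v n + lshift (op a v) n }.

(* Coefficient of lambda^m mu^n in
     a_lambda (b_mu v) - b_mu (a_lambda v) = [a_lambda b]_(lambda+mu) v,
   where the right-hand side is the sum over k and j of
     lambda^k (lambda + mu)^j ([a_lambda b]_k acting on v)_j.
   With act = br this is the Jacobi identity of a Lie conformal algebra. *)
Definition jacobi (F : fieldType) (A M : lmodType {poly F})
    (br : A -> A -> nat -> A) (act : A -> M -> nat -> M) (a b : A) (v : M) : Prop :=
  forall m n,
    act a (act b v n) m - act b (act a v m) n
    = \sum_(k < m.+1) act (br a b k) v (m - k + n)%N *+ 'C(m - k + n, n).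

(* Coefficient of lambda^m in [a_lambda b] = - [b_(-lambda-D) a], computed in
   C[D][lambda] = {poly {poly F}}: there lambda is 'X and D is 'X%:P. N is any
   bound on the degree of [b_lambda a]. *)
Definition skew_symmetric (F : fieldType) (A : lmodType {poly F})
    (br : A -> A -> nat -> A) (a b : A) : Prop :=
  forall N, (forall n, (N <= n)%N -> br b a n = 0) -> forall m,
    br a b m = - \sum_(n < N) ((- 'X - 'X%:P : {poly {poly F}}) ^+ n)`_m *: br b a n.

Record lie_conformal_algebra (F : fieldType) := LieConformalAlgebra {
  lca_sort :> lmodType {poly F};
  lca_bracket : lca_sort -> lca_sort -> nat -> lca_sort;
  lca_product : lambda_product lca_bracket;
  lca_skew : forall a b, skew_symmetric lca_bracket a b;
  lca_jacobi : forall a b c, jacobi lca_bracket lca_bracket a b c }.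

Record conformal_module (F : fieldType) (R : lie_conformal_algebra F) := ConformalModule {
  cm_sort :> lmodType {poly F};
  cm_action : R -> cm_sort -> nat -> cm_sort;
  cm_product : lambda_product cm_action;
  cm_jacobi : forall a b v, jacobi (@lca_bracket F R) cm_action a b v }.

Section ModuleNotions.
Context (F : fieldType) (R : lie_conformal_algebra F).
Implicit Types V W : conformal_module R.

Definition cm_finite V : Prop :=
  exists (n : nat) (g : 'I_n -> V), forall v, exists c : 'I_n -> {poly F},
    v = \sum_(i < n) c i *: g i.

Definition cm_nontrivial V : Prop := ~ (forall a (v : V) n, cm_action a v n = 0).

Record submodule V (S : V -> Prop) : Prop := Submodule {
  submod0 : S 0;
  submodD : forall v w, S v -> S w -> S (v + w);
  submodZ : forall (f : {poly F}) v, S v -> S (f *: v);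
  submod_act : forall a v n, S v -> S (cm_action a v n) }.

Definition cm_irreducible V : Prop :=
  (exists v : V, v <> 0) /\
  (forall S : V -> Prop, submodule S -> (forall v, S v <-> v = 0) \/ (forall v, S v)).

Definition cm_isomorphic V W : Prop :=
  exists phi : {linear V -> W},
    bijective phi /\ forall a v n, phi (cm_action a v n) = cm_action a (phi v) n.

End ModuleNotions.

Section Propagation.
Context (F : fieldType) (A M : lmodType {poly F}).
Context (op : A -> M -> nat -> M) (H : lambda_product op).

Lemma lp0l v n : op 0 v n = 0.
Proof.
have := lp_linl H 1 0 0 v n; rewrite scaler0 addr0 scale1r.
by rewrite -[LHS]addr0 => /addrI.
Qed.

Lemma lp0r a n : op a 0 n = 0.
Proof.
have := lp_linr H 1 a 0 0 n; rewrite scaler0 addr0 scale1r.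
by rewrite -[LHS]addr0 => /addrI.
Qed.

Lemma lpDl a a' v n : op (a + a') v n = op a v n + op a' v n.
Proof. by have := lp_linl H 1 a a' v n; rewrite !scale1r. Qed.

Lemma lpDr a v v' n : op a (v + v') n = op a v n + op a v' n.
Proof. by have := lp_linr H 1 a v v' n; rewrite !scale1r. Qed.

Lemma lpZl (c : F) a v n : op (c%:P *: a) v n = c%:P *: op a v n.
Proof. by have := lp_linl H c a 0 v n; rewrite !addr0 lp0l addr0. Qed.

Lemma lpZr (c : F) a v n : op a (c%:P *: v) n = c%:P *: op a v n.
Proof. by have := lp_linr H c a v 0 n; rewrite !addr0 lp0r addr0. Qed.

Lemma lpNl a v n : op (- a) v n = - op a v n.
Proof. by apply/eqP; rewrite -addr_eq0 -lpDl addNr lp0l. Qed.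

Lemma lpNr a v n : op a (- v) n = - op a v n.
Proof. by apply/eqP; rewrite -addr_eq0 -lpDr addNr lp0r. Qed.

Lemma poly_lmod_ind (P : A -> Prop) (x : A) :
    (forall (c : F) a a', P a -> P a' -> P (c%:P *: a + a')) ->
    (forall a, P a -> P ('X *: a)) -> P 0 -> P x -> forall f : {poly F}, P (f *: x).
Proof.
move=> Plin PX P0 Px; elim/poly_ind => [|f c IH]; first by rewrite scale0r.
by rewrite scalerDl addrC mulrC -scalerA; apply: Plin => //; apply: PX.
Qed.

End Propagation.

Section JacobiPropagation.
Context (F : fieldType) (A M : lmodType {poly F}).
Context (br : A -> A -> nat -> A) (act : A -> M -> nat -> M).
Context (Hbr : lambda_product br) (Hact : lambda_product act).
Let J := jacobi br act.

Lemma jacobi_linl (c : F) a a' b v : J a b v -> J a' b v -> J (c%:P *: a + a') b v.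
Proof.
move=> h h' m n; rewrite !(lp_linl Hact) (lp_linr Hact).
rewrite opprD addrACA -scalerBr h h' scaler_sumr -big_split /=.
by apply: eq_bigr => k _; rewrite (lp_linl Hbr) (lp_linl Hact) mulrnDl scalerMnr.
Qed.

Lemma jacobi_linm (c : F) a b b' v : J a b v -> J a b' v -> J a (c%:P *: b + b') v.
Proof.
move=> h h' m n; rewrite !(lp_linl Hact) (lp_linr Hact).
rewrite opprD addrACA -scalerBr h h' scaler_sumr -big_split /=.
by apply: eq_bigr => k _; rewrite (lp_linr Hbr) (lp_linl Hact) mulrnDl scalerMnr.
Qed.

Lemma jacobi_linr (c : F) a b v v' : J a b v -> J a b v' -> J a b (c%:P *: v + v').
Proof.
move=> h h' m n; rewrite !(lp_linr Hact).
rewrite opprD addrACA -scalerBr h h' scaler_sumr -big_split /=.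
by apply: eq_bigr => k _; rewrite (lp_linr Hact) mulrnDl scalerMnr.
Qed.

Lemma jacobi_dl a b v : J a b v -> J ('X *: a) b v.
Proof.
move=> h m n; rewrite !(lp_dl Hact) (lpNr Hact) opprK big_ord_recl (lp_dl Hbr).
rewrite /= oppr0 (lp0l Hact) mul0rn add0r.
case: m => [|m] /=; first by rewrite (lp0r Hact) oppr0 big_ord0 addr0.
rewrite addrC -opprB h -sumrN.
by apply: eq_bigr => k _; rewrite (lp_dl Hbr) (lpNl Hact) /= mulNrn.
Qed.

Lemma jacobi_dm a b v : J a b v -> J a ('X *: b) v.
Proof.
move=> h m n; rewrite !(lp_dl Hact) (lpNr Hact).
under eq_bigr do rewrite (lp_dr Hbr) (lpDl Hact) (lp_dl Hact) mulrnDl.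
rewrite big_split /= [X in _ = _ + X]big_ord_recl /= (lp0l Hact) mul0rn add0r.
rewrite [X in _ = X + _]big_ord_recr /= subnn add0n binn.
case: n => [|n] /=.
  rewrite (lp0r Hact) !oppr0 addr0 mulr1n addr0 -big_split big1 //= => k _.
  rewrite !bin0 !mulr1n !addn0 /bump /= add1n.
  have -> : (m - k = (m - k.+1).+1)%N by have := ltn_ord k; lia.
  by rewrite /= addNr.
rewrite -opprD h big_ord_recr /= subnn add0n binn mulr1n opprD.
rewrite addrAC; congr (_ - _); rewrite -sumrN -big_split; apply: eq_bigr => k _ /=.
rewrite /bump /= add1n.
have -> : (m - k = (m - k.+1).+1)%N by have := ltn_ord k; lia.
set r := (m - k.+1)%N; rewrite [(r.+1 + n.+1)%N]addSn binS -addSnnS add0n /=.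
by rewrite mulrnDr mulNrn mulNrn addrAC addNr add0r.
Qed.

Lemma jacobi_dr a b v : J a b v -> J a b ('X *: v).
Proof.
move=> h m n; rewrite !(lp_dr Hact) !(lpDr Hact) !(lp_dr Hact).
under eq_bigr do rewrite (lp_dr Hact) mulrnDl scalerMnr.
rewrite big_split /= -scaler_sumr -h scalerBr.
set x := 'X *: _; set y := 'X *: _; set s1 := lshift _ m; set t1 := act a _ m.
set s2 := lshift _ n; set t2 := act b _ n.
have -> : x + s1 + t1 - (y + s2 + t2) = x - y + (s1 - t2 + (t1 - s2)).
  by rewrite !opprD (AC (3*3) ((1*4)*((2*6)*(3*5)))).
congr (_ + _); rewrite /s1 /t1 /s2 /t2; clear x y s1 t1 s2 t2.
case: n => [|n] /=.
  rewrite (lp0r Hact) subr0 addr0.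
  case: m => [|m] /=; first by rewrite (lp0r Hact) subrr big_ord1.
  rewrite h [RHS]big_ord_recr /= subnn /= mul0rn addr0; apply: eq_bigr => k _.
  have -> : (m.+1 - k = (m - k).+1)%N by have := ltn_ord k; lia.
  by rewrite /= !bin0.
rewrite h big_ord_recr /= subnn add0n binn mulr1n.
rewrite [X in _ = X]big_ord_recr /= subnn /= add0n binn mulr1n addrA; congr (_ + _).
case: m => [|m] /=; first by rewrite (lp0r Hact) !big_ord0 subrr addr0.
rewrite h -big_split; apply: eq_bigr => k _ /=.
have -> : (m.+1 - k = (m - k).+1)%N by have := ltn_ord k; lia.
by rewrite /= [((m - k).+1 + n.+1)%N]addSn binS -addSnnS mulrnDr.
Qed.

Lemma jacobi_scale (f g e : {poly F}) a b v :
  J a b v -> J (f *: a) (g *: b) (e *: v).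
Proof.
have J0l y w : J 0 y w.
  move=> m n; rewrite !(lp0l Hact) (lp0r Hact) subrr big1 // => k _.
  by rewrite (lp0l Hbr) (lp0l Hact) mul0rn.
have J0m x w : J x 0 w.
  move=> m n; rewrite !(lp0l Hact) (lp0r Hact) subrr big1 // => k _.
  by rewrite (lp0r Hbr) (lp0l Hact) mul0rn.
have J0r x y : J x y 0.
  by move=> m n; rewrite !(lp0r Hact) subrr big1 // => k _; rewrite (lp0r Hact) mul0rn.
move=> h; apply: (poly_lmod_ind (P := fun x => J x _ _)) => //.
- by move=> *; apply: jacobi_linl.
- by move=> *; apply: jacobi_dl.
apply: (poly_lmod_ind (P := fun x => J _ x _)) => //.
- by move=> *; apply: jacobi_linm.
- by move=> *; apply: jacobi_dm.
apply: (poly_lmod_ind (P := fun x => J _ _ x)) => //.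
- by move=> *; apply: jacobi_linr.
- by move=> *; apply: jacobi_dr.
Qed.
End JacobiPropagation.

Section Sesquilinear.
Context (F : fieldType).
Implicit Types (f g : {poly F}) (K : {poly {poly F}}).

(* If e1_lambda e2 = K(D, lambda) e3 with K in C[D][lambda] = {poly {poly F}}, then
   (f(D) e1)_lambda (g(D) e2) = f(-lambda) g(D + lambda) K(D, lambda) e3. *)
Definition sesqui_ext f g K : {poly {poly F}} :=
  (f^:P \Po (- 'X)) * (g^:P \Po ('X%:P + 'X)) * K.

Lemma sesqui_linl (c : F) f f' g K n :
  (sesqui_ext (c%:P * f + f') g K)`_n = c%:P * (sesqui_ext f g K)`_n + (sesqui_ext f' g K)`_n.
Proof.
rewrite /sesqui_ext rmorphD rmorphM /= map_polyC /= comp_polyD comp_polyM comp_polyC.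
by rewrite !mulrDl coefD -!mulrA coefCM.
Qed.

Lemma sesqui_linr (c : F) f g g' K n :
  (sesqui_ext f (c%:P * g + g') K)`_n = c%:P * (sesqui_ext f g K)`_n + (sesqui_ext f g' K)`_n.
Proof.
rewrite /sesqui_ext rmorphD rmorphM /= map_polyC /= comp_polyD comp_polyM comp_polyC.
rewrite mulrDr !mulrDl coefD; congr (_ + _).
by rewrite mulrCA -!mulrA coefCM !mulrA.
Qed.

Lemma sesqui0l g K : sesqui_ext 0 g K = 0.
Proof. by rewrite /sesqui_ext rmorph0 comp_poly0 !mul0r. Qed.

Lemma sesqui0r f K : sesqui_ext f 0 K = 0.
Proof. by rewrite /sesqui_ext rmorph0 comp_poly0 mulr0 mul0r. Qed.

Lemma sesqui1 K : sesqui_ext 1 1 K = K.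
Proof. by rewrite /sesqui_ext rmorph1 comp_polyC /= comp_polyC !mul1r. Qed.

Lemma sesqui_dl f g K n :
  (sesqui_ext ('X * f) g K)`_n = - lshift (M := {poly F}^o) (fun k => (sesqui_ext f g K)`_k) n.
Proof.
rewrite /sesqui_ext rmorphM /= map_polyX comp_polyM comp_polyX !mulNr coefN -!mulrA coefXM.
by case: n.
Qed.

Lemma sesqui_dr f g K n :
  (sesqui_ext f ('X * g) K)`_n
  = 'X * (sesqui_ext f g K)`_n + lshift (M := {poly F}^o) (fun k => (sesqui_ext f g K)`_k) n.
Proof.
rewrite /sesqui_ext rmorphM /= map_polyX comp_polyM comp_polyX mulrCA -!mulrA.
by rewrite mulrDl coefD coefCM coefXM; case: n.
Qed.

(* Here f and g lie in the free C[D]-module on the monomials t^i, also encoded as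
   {poly {poly F}} but with outer variable t; the product extends
   t^i_lambda t^j = k(i,j) t^(i+j) sesquilinearly. The result is its n-th
   coefficient in lambda. *)
Definition sesqui_sum (k : nat -> nat -> {poly {poly F}}) (f g : {poly {poly F}})
    (n : nat) : {poly {poly F}} :=
  \sum_(i < size f) \sum_(j < size g) (sesqui_ext f`_i g`_j (k i j))`_n *: 'X^(i + j).

Lemma sesqui_sum_widen k (f g : {poly {poly F}}) N N' n :
    (size f <= N)%N -> (size g <= N')%N ->
  sesqui_sum k f g n
  = \sum_(i < N) \sum_(j < N') (sesqui_ext f`_i g`_j (k i j))`_n *: 'X^(i + j).
Proof.
move=> hN hN'; rewrite /sesqui_sum.
rewrite (big_ord_widen N (fun i => \sum_(j < size g) (sesqui_ext f`_i g`_j (k i j))`_n *: 'X^(i + j))) //.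
rewrite big_mkcond; apply: eq_bigr => i _; case: ltnP => hi; last first.
  by rewrite big1 // => j _; rewrite [f`_i]nth_default // sesqui0l coef0 scale0r.
rewrite (big_ord_widen N' (fun j => (sesqui_ext f`_i g`_j (k i j))`_n *: 'X^(i + j))) //.
rewrite big_mkcond; apply: eq_bigr => j _; case: ltnP => hj //.
by rewrite [g`_j]nth_default // sesqui0r coef0 scale0r.
Qed.

Lemma sesqui_sum_linl k (c : F) (f f' g : {poly {poly F}}) n :
  sesqui_sum k (c%:P *: f + f') g n = c%:P *: sesqui_sum k f g n + sesqui_sum k f' g n.
Proof.
pose N := maxn (size (c%:P *: f + f')) (maxn (size f) (size f')).
rewrite !(@sesqui_sum_widen k _ g N (size g)) ?leq_max ?leqnn ?orbT //.
rewrite scaler_sumr -big_split; apply: eq_bigr => i _ /=.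
rewrite scaler_sumr -big_split; apply: eq_bigr => j _ /=.
by rewrite coefD coefZ sesqui_linl scalerDl scalerA.
Qed.

Lemma sesqui_sum_linr k (c : F) (f g g' : {poly {poly F}}) n :
  sesqui_sum k f (c%:P *: g + g') n = c%:P *: sesqui_sum k f g n + sesqui_sum k f g' n.
Proof.
pose N := maxn (size (c%:P *: g + g')) (maxn (size g) (size g')).
rewrite !(@sesqui_sum_widen k f _ (size f) N) ?leq_max ?leqnn ?orbT //.
rewrite scaler_sumr -big_split; apply: eq_bigr => i _ /=.
rewrite scaler_sumr -big_split; apply: eq_bigr => j _ /=.
by rewrite coefD coefZ sesqui_linr scalerDl scalerA.
Qed.

Lemma sesqui_sum_dl k (f g : {poly {poly F}}) n :
  sesqui_sum k ('X *: f) g n = - lshift (sesqui_sum k f g) n.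
Proof.
pose N := maxn (size ('X *: f)) (size f).
rewrite (@sesqui_sum_widen k _ g N (size g)) ?leq_max ?leqnn ?orbT //.
case: n => [|n] /=.
  rewrite oppr0 big1 // => i _; rewrite big1 // => j _.
  by rewrite coefZ sesqui_dl /= oppr0 scale0r.
rewrite (@sesqui_sum_widen k f g N (size g)) ?leq_max ?leqnn ?orbT //.
rewrite -sumrN; apply: eq_bigr => i _; rewrite -sumrN; apply: eq_bigr => j _.
by rewrite coefZ sesqui_dl scaleNr.
Qed.

Lemma sesqui_sum_dr k (f g : {poly {poly F}}) n :
  sesqui_sum k f ('X *: g) n = 'X *: sesqui_sum k f g n + lshift (sesqui_sum k f g) n.
Proof.
pose N := maxn (size ('X *: g)) (size g).
case: n => [|n] /=; rewrite !(@sesqui_sum_widen k f _ (size f) N) ?leq_max ?leqnn ?orbT //.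
  rewrite addr0 scaler_sumr; apply: eq_bigr => i _; rewrite scaler_sumr; apply: eq_bigr => j _.
  by rewrite coefZ sesqui_dr /= addr0 scalerA.
rewrite scaler_sumr -big_split; apply: eq_bigr => i _ /=.
rewrite scaler_sumr -big_split; apply: eq_bigr => j _ /=.
by rewrite coefZ sesqui_dr /= scalerDl scalerA.
Qed.

Lemma sum_eventually0 (M : lmodType {poly F}) m (P : 'I_m -> nat -> M) :
    (forall i, exists N, forall n, (N <= n)%N -> P i n = 0) ->
  exists N, forall n, (N <= n)%N -> \sum_(i < m) P i n = 0.
Proof.
elim: m P => [|m IH] P h; first by exists 0%N => n _; rewrite big_ord0.
have [N hN] := IH (fun i => P (widen_ord (leqnSn m) i)) (fun i => h _).
have [N' hN'] := h ord_max; exists (maxn N N') => n; rewrite geq_max => /andP[h1 h2].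
by rewrite big_ord_recr /= hN // hN' // addr0.
Qed.

Lemma sesqui_sum_fin k (f g : {poly {poly F}}) :
  exists N, forall n, (N <= n)%N -> sesqui_sum k f g n = 0.
Proof.
apply: sum_eventually0 => i; apply: sum_eventually0 => j.
exists (size (sesqui_ext f`_i g`_j (k i j))) => n hn.
by rewrite nth_default // scale0r.
Qed.

Lemma sesqui_sumXn k i j n :
  sesqui_sum k 'X^i 'X^j n = (k i j)`_n *: 'X^(i + j).
Proof.
rewrite /sesqui_sum !size_polyXn big_ord_recr /= big1 ?add0r => [|i' _].
  rewrite big_ord_recr /= big1 ?add0r => [|j' _]; first by rewrite !coefXn !eqxx sesqui1.
  by rewrite coefXn [X in sesqui_ext _ X]coefXn (ltn_eqF (ltn_ord j')) sesqui0r coef0 scale0r.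
by rewrite big1 // => j' _; rewrite [X in sesqui_ext X]coefXn (ltn_eqF (ltn_ord i')) sesqui0l coef0 scale0r.
Qed.

(* Substitution of -lambda - D for lambda. *)
Definition skew_subst (K : {poly {poly F}}) : {poly {poly F}} := K \Po (- 'X - 'X%:P).

Lemma sesqui_skew f g K : skew_subst (sesqui_ext f g K) = sesqui_ext g f (skew_subst K).
Proof.
rewrite /skew_subst /sesqui_ext !comp_polyM -!comp_polyA !raddfN /= !raddfD /= !comp_polyX !comp_polyC.
have -> : 'X%:P + (- 'X - 'X%:P) = - 'X :> {poly {poly F}} by rewrite addrC subrK.
have -> : - (- 'X - 'X%:P) = 'X%:P + 'X :> {poly {poly F}} by rewrite opprB opprK.
by rewrite [X in X * _]mulrC.
Qed.

Lemma coef_skew_subst K N m : (size K <= N)%N ->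
  (skew_subst K)`_m = \sum_(n < N) ((- 'X - 'X%:P : {poly {poly F}}) ^+ n)`_m * K`_n.
Proof.
move=> hN; rewrite /skew_subst comp_polyE coef_sum.
rewrite (big_ord_widen N (fun n => (K`_n *: (- 'X - 'X%:P) ^+ n)`_m)) // big_mkcond.
apply: eq_bigr => i _; case: ltnP => hi; first by rewrite coefZ mulrC.
by rewrite [K`_i]nth_default // mulr0.
Qed.

Lemma skew_sum_widen (M : lmodType {poly F}) (P : nat -> M) N N' m :
    (forall n, (N <= n)%N -> P n = 0) -> (N <= N')%N ->
  \sum_(n < N) ((- 'X - 'X%:P : {poly {poly F}}) ^+ n)`_m *: P n
  = \sum_(n < N') ((- 'X - 'X%:P : {poly {poly F}}) ^+ n)`_m *: P n.
Proof.
move=> h hN.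
rewrite (big_ord_widen N' (fun n => ((- 'X - 'X%:P : {poly {poly F}}) ^+ n)`_m *: P n)) //.
rewrite big_mkcond; apply: eq_bigr => i _; case: ltnP => hi //.
by rewrite h // scaler0.
Qed.

Lemma sesqui_sum_skew k k' (f g : {poly {poly F}}) :
    (forall i j, k i j = - skew_subst (k' j i)) ->
  exists N0, forall N m, (N0 <= N)%N ->
  sesqui_sum k f g m
  = - \sum_(n < N) ((- 'X - 'X%:P : {poly {poly F}}) ^+ n)`_m *: sesqui_sum k' g f n.
Proof.
move=> hk.
exists (\max_(i < size f) \max_(j < size g) size (sesqui_ext g`_j f`_i (k' j i))) => N m hN.
under [X in _ = - X]eq_bigr do rewrite /sesqui_sum exchange_big scaler_sumr /=.
rewrite [X in _ = - X]exchange_big -sumrN /sesqui_sum; apply: eq_bigr => i _ /=.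
under [X in _ = - X]eq_bigr do rewrite scaler_sumr /=.
rewrite [X in _ = - X]exchange_big -sumrN /=; apply: eq_bigr => j _.
have hs : (size (sesqui_ext g`_j f`_i (k' j i)) <= N)%N.
  apply: leq_trans hN; apply: leq_trans (leq_bigmax i).
  exact: leq_bigmax j.
under eq_bigr do rewrite scalerA addnC.
rewrite -scaler_suml -coef_skew_subst // sesqui_skew hk -scaleNr -coefN; congr (_`_ _ *: _).
by rewrite /sesqui_ext mulrN.
Qed.

End Sesquilinear.

Section AffineJacobi.
Context (F : fieldType) (A M : lmodType {poly F}).
Context (br : A -> A -> nat -> A) (act : A -> M -> nat -> M).
Context (Hbr : lambda_product br) (Hact : lambda_product act).

Definition affine_coef (u w z : F) (n : nat) : {poly F} :=
  match n with 0%N => u%:P * 'X + z%:P | 1%N => w%:P | _ => 0 end.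

Definition affine_r (u2 w2 z2 u1 w1 z1 : F) n m : {poly F} :=
  match n with
  | 0%N => u2%:P * ('X * affine_coef u1 w1 z1 m
                    + (if m is k.+1 then affine_coef u1 w1 z1 k else 0))
           + z2%:P * affine_coef u1 w1 z1 m
  | 1%N => w2%:P * affine_coef u1 w1 z1 m
  | _ => 0 end.

Definition affine_l (u2 w2 z2 u1 w1 z1 : F) n m : {poly F} :=
  match n with
  | 0%N => - (u2%:P * (if m is k.+1 then affine_coef u1 w1 z1 k else 0))
           + z2%:P * affine_coef u1 w1 z1 m
  | 1%N => w2%:P * affine_coef u1 w1 z1 m
  | _ => 0 end.

Lemma act_affine_r a e2 e u2 w2 z2 u1 w1 z1 n m :
    (forall n, act a e2 n = affine_coef u1 w1 z1 n *: e) ->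
  act a (affine_coef u2 w2 z2 n *: e2) m = affine_r u2 w2 z2 u1 w1 z1 n m *: e.
Proof.
move=> h; case: n => [|[|n]] /=; last by rewrite !scale0r (lp0r Hact).
  rewrite !scalerDl -!scalerA (lp_linr Hact) (lpZr Hact) (lp_dr Hact) h scalerDl -scalerA.
  by congr (_ *: (_ + _) + _); case: m => [|m] /=; rewrite ?scale0r ?h.
by rewrite (lpZr Hact) h scalerA.
Qed.

Lemma act_affine_l e3 v e u2 w2 z2 u1 w1 z1 n m :
    (forall n, act e3 v n = affine_coef u1 w1 z1 n *: e) ->
  act (affine_coef u2 w2 z2 n *: e3) v m = affine_l u2 w2 z2 u1 w1 z1 n m *: e.
Proof.
move=> h; case: n => [|[|n]] /=; last by rewrite !scale0r (lp0l Hact).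
  rewrite !scalerDl -!scalerA (lp_linl Hact) (lpZl Hact) (lp_dl Hact) h scaleNr -!scalerA scalerN.
  by congr (- (_ *: _) + _); case: m => [|m] /=; rewrite ?scale0r ?h.
by rewrite (lpZl Hact) h scalerA.
Qed.

Lemma affine_jacobi a b v e2 e2' e3 e
    (u1 w1 z1 u2 w2 z2 v1 x1 y1 v2 x2 y2 u3 w3 z3 u4 w4 z4 : F) :
  (forall n, act b v n = affine_coef u2 w2 z2 n *: e2) ->
  (forall n, act a e2 n = affine_coef u1 w1 z1 n *: e) ->
  (forall n, act a v n = affine_coef v2 x2 y2 n *: e2') ->
  (forall n, act b e2' n = affine_coef v1 x1 y1 n *: e) ->
  (forall n, br a b n = affine_coef u3 w3 z3 n *: e3) ->
  (forall n, act e3 v n = affine_coef u4 w4 z4 n *: e) ->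
  [/\ (u2 * u1 = v2 * v1), (u2 * z1 + z2 * u1 - v2 * y1 - y2 * v1 = z3 * u4)
    & (z2 * z1 - y2 * y1 = z3 * z4)] ->
  [/\ (u2 * w1 + u2 * u1 - x2 * v1 = (w3 - u3) * u4)
    & (z2 * w1 + u2 * z1 - x2 * y1 = (w3 - u3) * z4 + z3 * w4)] ->
  [/\ (w2 * u1 - v2 * x1 - v2 * v1 = - u3 * u4)
    & (w2 * z1 - y2 * x1 - v2 * y1 = - u3 * z4 + z3 * w4)] ->
  [/\ (w2 * w1 - x2 * x1 = (w3 - 2 * u3) * w4),
      (u2 * w1 = (w3 - u3) * w4) & (v2 * x1 = u3 * w4)] ->
  jacobi br act a b v.
Proof.
move=> hbv ha hav hb hbr h3 [e1 e2_ e3_] [e4 e5] [e6 e7] [e8 e9 e10] m n.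
have key (L R K : {poly F}) : K = 0 -> L - R = K -> L = R.
  by move=> -> /eqP; rewrite subr_eq0 => /eqP.
rewrite hbv hav (act_affine_r _ _ _ _ _ ha) (act_affine_r _ _ _ _ _ hb) -scalerBl.
under eq_bigr do rewrite hbr (act_affine_l _ _ _ _ _ h3) scalerMnl.
rewrite -scaler_suml; congr (_ *: _).
pose G i j := affine_l u3 w3 z3 u4 w4 z4 i j.
have sumE : \sum_(i < m.+1) G i (m - i + n)%N *+ 'C(m - i + n, n)
    = G 0%N (m + n)%N *+ 'C(m + n, n)
      + (if m is k.+1 then G 1%N (k + n)%N *+ 'C(k + n, n) else 0).
  rewrite big_ord_recl /= subn0; congr (_ + _); case: m => [|m]; first by rewrite big_ord0.
  rewrite big_ord_recl /= /bump /= ?add0n ?add1n ?subSS ?subn0 big1 ?addr0 // => i _.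
  by rewrite /G /= mul0rn.
rewrite sumE {sumE}/G.
have sub0 (x y : F) : x = y -> x - y = 0 by move=> ->; rewrite subrr.
move/sub0 in e1; move/sub0 in e2_; move/sub0 in e3_; move/sub0 in e4; move/sub0 in e5.
move/sub0 in e6; move/sub0 in e7; move/sub0 in e8; move/sub0 in e9; move/sub0 in e10.
case: m => [|[|[|m]]]; case: n => [|[|[|n]]];
  rewrite ?(addSn, addnS, addn0, add0n) /= ?(mulr0, mul0r, addr0, subr0, oppr0, mul0rn, subrr, add0r) //.
- apply: (key _ _ ('X^2 * (u2 * u1 - v2 * v1)%:P
     + 'X * (u2 * z1 + z2 * u1 - v2 * y1 - y2 * v1 - z3 * u4)%:P
     + (z2 * z1 - y2 * y1 - z3 * z4)%:P)); last by rewrite ?bin0; ring.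
  by rewrite e1 e2_ e3_ polyC0 !mulr0 !addr0.
- apply: (key _ _ ('X * (w2 * u1 - v2 * x1 - v2 * v1 - - u3 * u4)%:P
     + (w2 * z1 - y2 * x1 - v2 * y1 - (- u3 * z4 + z3 * w4))%:P)); last by rewrite binn; ring.
  by rewrite e6 e7 polyC0 mulr0 addr0.
- apply: (key _ _ (- (v2 * x1 - u3 * w4)%:P)); last by rewrite binn; ring.
  by rewrite e10 polyC0 oppr0.
- apply: (key _ _ ('X * (u2 * w1 + u2 * u1 - x2 * v1 - (w3 - u3) * u4)%:P
     + (z2 * w1 + u2 * z1 - x2 * y1 - ((w3 - u3) * z4 + z3 * w4))%:P)); last by rewrite !bin0; ring.
  by rewrite e4 e5 polyC0 mulr0 addr0.
- apply: (key _ _ (w2 * w1 - x2 * x1 - (w3 - 2 * u3) * w4)%:P); first by rewrite e8.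
  by rewrite bin1 binn; ring.
- apply: (key _ _ (u2 * w1 - (w3 - u3) * w4)%:P); first by rewrite e9.
  by rewrite !bin0; ring.
Qed.

End AffineJacobi.

Section BAlgebra.
Context (F : fieldType) (alpha beta p : F).

Local Notation D := ('X%:P : {poly {poly F}}).
Local Notation Lam := ('X : {poly {poly F}}).
Local Notation "c %:K" := (c%:P%:P : {poly {poly F}}) (at level 1, format "c %:K").

Definition kerLL (i j : nat) : {poly {poly F}} :=
  (i%:R + p)%:K * D + (i%:R + j%:R + 2 * p)%:K * Lam.

Definition kerLW (i j : nat) : {poly {poly F}} :=
  (i%:R + p)%:K * (D + beta%:K) + (i%:R + j%:R + alpha)%:K * Lam.

(* Forced by skew-symmetry: [W_i_lambda L_j] = - [L_j_(-lambda-D) W_i]. *)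
Definition kerWL (i j : nat) : {poly {poly F}} := - skew_subst (kerLW j i).

(* The first component is the span of the L_i = ('X^i, 0), the second one that
   of the W_i = (0, 'X^i). *)
Definition B_carrier : lmodType {poly F} := ({poly {poly F}} * {poly {poly F}})%type.

Definition B_bracket (x y : B_carrier) (n : nat) : B_carrier :=
  (sesqui_sum kerLL x.1 y.1 n,
   sesqui_sum kerLW x.1 y.2 n + sesqui_sum kerWL x.2 y.1 n).

Definition B_L (i : nat) : B_carrier := ('X^i, 0).
Definition B_W (i : nat) : B_carrier := (0, 'X^i).

Lemma coef_affine (u w z : F) n :
  (u%:K * D + z%:K + w%:K * Lam)`_n = affine_coef u w z n.
Proof.
rewrite -!polyCM -polyCD coefD coefC coefCM coefX.
by case: n => [|[|n]] /=; rewrite ?mulr0 ?mulr1 ?addr0 ?add0r.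
Qed.

Lemma kerLL_coef i j n :
  (kerLL i j)`_n = affine_coef (i%:R + p) (i%:R + j%:R + 2 * p) 0 n.
Proof. by rewrite -coef_affine polyC0 addr0. Qed.

Lemma kerLW_coef i j n :
  (kerLW i j)`_n = affine_coef (i%:R + p) (i%:R + j%:R + alpha) ((i%:R + p) * beta) n.
Proof. by rewrite -coef_affine /kerLW mulrDr !polyCM. Qed.

Lemma kerWL_coef i j n :
  (kerWL i j)`_n = affine_coef (i%:R + alpha - p) (i%:R + j%:R + alpha) (- ((j%:R + p) * beta)) n.
Proof.
rewrite -coef_affine /kerWL /kerLW /skew_subst comp_polyD !comp_polyM comp_polyD comp_polyX !comp_polyC.
by congr (nth 0 (polyseq _) n); ring.
Qed.

Lemma sesqui_sum0l k (g : {poly {poly F}}) n : sesqui_sum k 0 g n = 0.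
Proof. by rewrite /sesqui_sum size_poly0 big_ord0. Qed.

Lemma sesqui_sum0r k (f : {poly {poly F}}) n : sesqui_sum k f 0 n = 0.
Proof. by rewrite /sesqui_sum size_poly0 big1 // => i _; rewrite big_ord0. Qed.

Let pairP (x y : B_carrier) : x.1 = y.1 -> x.2 = y.2 -> x = y.
Proof. by case: x y => [x1 x2] [y1 y2] /= -> ->. Qed.

Lemma B_bracketLL i j n : B_bracket (B_L i) (B_L j) n =
  affine_coef (i%:R + p) (i%:R + j%:R + 2 * p) 0 n *: B_L (i + j).
Proof.
apply: pairP; rewrite /= ?scaler0 ?(sesqui_sum0l, sesqui_sum0r) ?addr0 //.
by rewrite sesqui_sumXn kerLL_coef.
Qed.

Lemma B_bracketLW i j n : B_bracket (B_L i) (B_W j) n =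
  affine_coef (i%:R + p) (i%:R + j%:R + alpha) ((i%:R + p) * beta) n *: B_W (i + j).
Proof.
apply: pairP; rewrite /= ?scaler0 ?(sesqui_sum0l, sesqui_sum0r) ?addr0 //.
by rewrite sesqui_sumXn kerLW_coef.
Qed.

Lemma B_bracketWL i j n : B_bracket (B_W i) (B_L j) n =
  affine_coef (i%:R + alpha - p) (i%:R + j%:R + alpha) (- ((j%:R + p) * beta)) n *: B_W (i + j).
Proof.
apply: pairP; rewrite /= ?scaler0 ?(sesqui_sum0l, sesqui_sum0r) ?add0r //.
by rewrite sesqui_sumXn kerWL_coef.
Qed.

Lemma B_bracketWW i j n : B_bracket (B_W i) (B_W j) n = 0.
Proof. by apply: pairP; rewrite /= ?(sesqui_sum0l, sesqui_sum0r) ?addr0. Qed.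

Lemma B_product : lambda_product B_bracket.
Proof.
split.
- move=> x y; have [N1 h1] := sesqui_sum_fin kerLL x.1 y.1.
  have [N2 h2] := sesqui_sum_fin kerLW x.1 y.2; have [N3 h3] := sesqui_sum_fin kerWL x.2 y.1.
  exists (maxn N1 (maxn N2 N3)) => n; rewrite !geq_max => /and3P[n1 n2 n3].
  by rewrite /B_bracket h1 // h2 // h3 // addr0.
- move=> c x x' y n; apply: pairP; rewrite /= !sesqui_sum_linl //.
  by rewrite scalerDr addrACA.
- move=> c x y y' n; apply: pairP; rewrite /= !sesqui_sum_linr //.
  by rewrite scalerDr addrACA.
- move=> x y n; apply: pairP; rewrite /= !sesqui_sum_dl; case: n => [|n] //=.
  by rewrite oppr0 addr0.
  by rewrite opprD.
- move=> x y n; apply: pairP; rewrite /= !sesqui_sum_dr; case: n => [|n] //=.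
  by rewrite !addr0 scalerDr.
  by rewrite scalerDr addrACA.
Qed.

Lemma skew_substK (K : {poly {poly F}}) : skew_subst (skew_subst K) = K.
Proof.
rewrite /skew_subst -comp_polyA raddfB /= raddfN /= comp_polyX comp_polyC.
by rewrite opprB opprK addrAC subrr add0r comp_polyXr.
Qed.

Lemma B_skew (x y : B_carrier) : skew_symmetric B_bracket x y.
Proof.
have kLL i j : kerLL i j = - skew_subst (kerLL j i).
  rewrite /kerLL /skew_subst comp_polyD !comp_polyM comp_polyX !comp_polyC; ring.
have kLW i j : kerLW i j = - skew_subst (kerWL j i).
  by rewrite /kerWL /skew_subst raddfN /= opprK -!/(skew_subst _) skew_substK.
have [N1 h1] := sesqui_sum_skew x.1 y.1 kLL.
have [N2 h2] := sesqui_sum_skew x.1 y.2 kLW.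
have [N3 h3] := sesqui_sum_skew x.2 y.1 (fun i j => erefl (kerWL i j)).
move=> N hN m; pose N' := maxn N (maxn N1 (maxn N2 N3)).
rewrite (skew_sum_widen (N' := N') _ hN) ?leq_maxl //.
apply: pairP; rewrite raddfN raddf_sum /=; first by apply: h1; rewrite !leq_max leqnn !orbT.
rewrite (h2 N' m) ?(h3 N' m) ?leq_max ?leqnn ?orbT //.
rewrite -opprD -big_split; apply: (congr1 -%R); apply: eq_bigr => n _ /=.
by rewrite scalerDr addrC.
Qed.

Lemma B_ind (P : B_carrier -> Prop) :
    P 0 -> (forall x y, P x -> P y -> P (x + y)) ->
    (forall (f : {poly F}) i, P (f *: B_L i)) ->
    (forall (f : {poly F}) i, P (f *: B_W i)) -> forall x, P x.
Proof.
move=> P0 PD PL PW [x1 x2].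
have -> : (x1, x2) = \sum_(i < size x1) x1`_i *: B_L i + \sum_(i < size x2) x2`_i *: B_W i.
  apply: pairP; rewrite raddfD !raddf_sum /= -[LHS]coefK poly_def.
    by rewrite [X in _ + X]big1 ?addr0 // => i _; rewrite scaler0.
  by rewrite [X in X + _]big1 ?add0r // => i _; rewrite scaler0.
apply: (PD); apply: (big_ind P) => //; auto.
Qed.

Let J := jacobi B_bracket B_bracket.

Lemma B_jacobi_gen (M : lmodType {poly F}) (act : B_carrier -> M -> nat -> M) (v : M) :
    lambda_product act ->
    (forall i j, jacobi B_bracket act (B_L i) (B_L j) v) ->
    (forall i j, jacobi B_bracket act (B_L i) (B_W j) v) ->
    (forall i j, jacobi B_bracket act (B_W i) (B_L j) v) ->
    (forall i j, jacobi B_bracket act (B_W i) (B_W j) v) ->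
  forall x y (f : {poly F}), jacobi B_bracket act x y (f *: v).
Proof.
move=> Hact LL LW WL WW x y f.
have J0l y' w : jacobi B_bracket act 0 y' w.
  move=> m n; rewrite !(lp0l Hact) (lp0r Hact) subrr big1 // => k _.
  by rewrite (lp0l B_product) (lp0l Hact) mul0rn.
have J0m y' w : jacobi B_bracket act y' 0 w.
  move=> m n; rewrite !(lp0l Hact) (lp0r Hact) subrr big1 // => k _.
  by rewrite (lp0r B_product) (lp0l Hact) mul0rn.
elim/B_ind: x => [//|x x' hx hx'|g i|g i].
- by rewrite -[x]scale1r; apply: (jacobi_linl B_product Hact).
- elim/B_ind: y => [//|y y' hy hy'|h j|h j].
  + by rewrite -[y]scale1r; apply: (jacobi_linm B_product Hact).
  + exact: jacobi_scale B_product Hact _ _ _ _ _ _ (LL i j).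
  + exact: jacobi_scale B_product Hact _ _ _ _ _ _ (LW i j).
- elim/B_ind: y => [//|y y' hy hy'|h j|h j].
  + by rewrite -[y]scale1r; apply: (jacobi_linm B_product Hact).
  + exact: jacobi_scale B_product Hact _ _ _ _ _ _ (WL i j).
  + exact: jacobi_scale B_product Hact _ _ _ _ _ _ (WW i j).
Qed.

Lemma affine_coef0 n : affine_coef (0 : F) 0 0 n = 0.
Proof. by case: n => [|[|n]] //=; rewrite polyC0 mul0r addr0. Qed.

Lemma B_jacobi (x y z : B_carrier) : J x y z.
Proof.
have LL := B_bracketLL; have LW := B_bracketLW; have WL := B_bracketWL.
have WW i j n : B_bracket (B_W i) (B_W j) n = affine_coef 0 0 0 n *: B_W (i + j).
  by rewrite B_bracketWW affine_coef0 scale0r.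
have AJ := affine_jacobi (br := B_bracket) B_product.
have comb (i j k : nat) : [/\ (i + (j + k) = i + j + k)%N & (j + (i + k) = i + j + k)%N].
  by split; lia.
elim/B_ind: z => [|z z' hz hz'|f k|f k].
- by move=> m n; rewrite !(lp0r B_product) subrr big1 // => k _; rewrite (lp0r B_product) mul0rn.
- by rewrite -[z]scale1r; apply: (jacobi_linr B_product).
- apply: (B_jacobi_gen B_product) => i j; have [c1 c2] := comb i j k.
  + apply: AJ => [n|n|n|n|n|n||||]; rewrite ?(LL, LW, WL, WW) ?c1 ?c2 //;
      by rewrite ?natrD; split; ring.
  + apply: AJ => [n|n|n|n|n|n||||]; rewrite ?(LL, LW, WL, WW) ?c1 ?c2 //;
      by rewrite ?natrD; split; ring.
  + apply: AJ => [n|n|n|n|n|n||||]; rewrite ?(LL, LW, WL, WW) ?c1 ?c2 //;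
      by rewrite ?natrD; split; ring.
  + apply: AJ => [n|n|n|n|n|n||||]; rewrite ?(LL, LW, WL, WW) ?c1 ?c2 //;
      by rewrite ?natrD; split; ring.
- apply: (B_jacobi_gen B_product) => i j; have [c1 c2] := comb i j k.
  + apply: AJ => [n|n|n|n|n|n||||]; rewrite ?(LL, LW, WL, WW) ?c1 ?c2 //;
      by rewrite ?natrD; split; ring.
  + apply: AJ => [n|n|n|n|n|n||||]; rewrite ?(LL, LW, WL, WW) ?c1 ?c2 //;
      by rewrite ?natrD; split; ring.
  + apply: AJ => [n|n|n|n|n|n||||]; rewrite ?(LL, LW, WL, WW) ?c1 ?c2 //;
      by rewrite ?natrD; split; ring.
  + apply: AJ => [n|n|n|n|n|n||||]; rewrite ?(LL, LW, WL, WW) ?c1 ?c2 //;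
      by rewrite ?natrD; split; ring.
Qed.

End BAlgebra.

Definition frakB (F : fieldType) (alpha beta p : F) : lie_conformal_algebra F :=
  LieConformalAlgebra (B_product alpha beta p) (@B_skew F alpha beta p)
    (@B_jacobi F alpha beta p).

Section RankOneModules.
Context (F : fieldType) (alpha beta p : F).
Local Notation D := ('X%:P : {poly {poly F}}).
Local Notation Lam := ('X : {poly {poly F}}).
Local Notation "c %:K" := (c%:P%:P : {poly {poly F}}) (at level 1, format "c %:K").

(* The module C[D]v is {poly F} as a module over itself, with v = 1. *)
Definition sesqui_row (k : nat -> {poly {poly F}}) (f : {poly {poly F}})
    (h : {poly F}^o) (n : nat) : {poly F}^o :=
  \sum_(i < size f) (sesqui_ext f`_i h (k i))`_n.

Lemma sesqui_row_widen k (f : {poly {poly F}}) h N n : (size f <= N)%N ->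
  sesqui_row k f h n = \sum_(i < N) (sesqui_ext f`_i h (k i))`_n.
Proof.
move=> hN; rewrite /sesqui_row (big_ord_widen N (fun i => (sesqui_ext f`_i h (k i))`_n)) //.
rewrite big_mkcond; apply: eq_bigr => i _; case: ltnP => hi //.
by rewrite [f`_i]nth_default // sesqui0l coef0.
Qed.

Lemma sesqui_row_product k : lambda_product (sesqui_row k).
Proof.
split.
- move=> f h; apply: sum_eventually0 => i.
  by exists (size (sesqui_ext f`_i h (k i))) => n hn; rewrite nth_default.
- move=> c f f' h n; pose N := maxn (size (c%:P *: f + f')) (maxn (size f) (size f')).
  rewrite !(@sesqui_row_widen k _ h N) ?leq_max ?leqnn ?orbT //.
  rewrite scaler_sumr -big_split; apply: eq_bigr => i _ /=.
  by rewrite coefD coefZ sesqui_linl.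
- move=> c f h h' n; rewrite /sesqui_row scaler_sumr -big_split; apply: eq_bigr => i _ /=.
  by rewrite sesqui_linr.
- move=> f h n; pose N := maxn (size ('X *: f)) (size f).
  rewrite (@sesqui_row_widen k _ h N) ?leq_max ?leqnn ?orbT //.
  case: n => [|n] /=.
    by rewrite oppr0 big1 // => i _; rewrite coefZ sesqui_dl /= oppr0.
  rewrite (@sesqui_row_widen k f h N) ?leq_max ?leqnn ?orbT //.
  by rewrite -sumrN; apply: eq_bigr => i _; rewrite coefZ sesqui_dl.
- move=> f h n; case: n => [|n] /=; rewrite /sesqui_row ?addr0 scaler_sumr -?big_split;
    by apply: eq_bigr => i _; rewrite sesqui_dr /= ?addr0.
Qed.

Lemma sesqui_rowXn k i n : sesqui_row k 'X^i 1 n = (k i)`_n.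
Proof.
rewrite /sesqui_row size_polyXn big_ord_recr /= big1 ?add0r => [|j _].
  by rewrite coefXn eqxx sesqui1.
by rewrite [X in sesqui_ext X]coefXn (ltn_eqF (ltn_ord j)) sesqui0l coef0.
Qed.

Definition ker_actL (a b c : F) (i : nat) : {poly {poly F}} :=
  match i with 0%N => p%:K * (D + a%:K * Lam + b%:K) | 1%N => c%:K | _ => 0 end.

Definition ker_actW (d : F) (i : nat) : {poly {poly F}} := if i == 0%N then d%:K else 0.

(* L_0_lambda v = p (D + a lambda + b) v, L_1_lambda v = c v, W_0_lambda v = d v,
   and all other L_i, W_i act by zero; this is a module only under the
   hypotheses of V_jacobi. *)
Definition V_action (a b c d : F) (x : B_carrier F) (h : {poly F}^o) (n : nat) : {poly F}^o :=
  sesqui_row (ker_actL a b c) x.1 h n + sesqui_row (ker_actW d) x.2 h n.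

Lemma V_actionL a b c d i n :
  V_action a b c d (B_L F i) 1 n = (ker_actL a b c i)`_n.
Proof. by rewrite /V_action /= (lp0l (sesqui_row_product _)) addr0 sesqui_rowXn. Qed.

Lemma V_actionW a b c d i n :
  V_action a b c d (B_W F i) 1 n = (ker_actW d i)`_n.
Proof. by rewrite /V_action /= (lp0l (sesqui_row_product _)) add0r sesqui_rowXn. Qed.

Lemma V_product a b c d : lambda_product (V_action a b c d).
Proof.
have [f1 ll1 lr1 dl1 dr1] := sesqui_row_product (ker_actL a b c).
have [f2 ll2 lr2 dl2 dr2] := sesqui_row_product (ker_actW d).
split; rewrite /V_action.
- move=> x h; have [N1 h1] := f1 x.1 h; have [N2 h2] := f2 x.2 h.
  by exists (maxn N1 N2) => n; rewrite geq_max => /andP[n1 n2]; rewrite h1 // h2 // addr0.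
- by move=> e x x' h n; rewrite /= ll1 ll2 scalerDr addrACA.
- by move=> e x h h' n; rewrite /= lr1 lr2 scalerDr addrACA.
- move=> x h n; rewrite /= dl1 dl2; case: n => [|n] /=; first by rewrite oppr0 addr0.
  by rewrite opprD.
- move=> x h n; rewrite /= dr1 dr2; case: n => [|n] /=; first by rewrite !addr0 scalerDr.
  by rewrite scalerDr addrACA.
Qed.

Definition affL (a b c : F) (i : nat) : F * F * F :=
  match i with 0%N => (p, p * a, p * b) | 1%N => (0, 0, c) | _ => (0, 0, 0) end.

Lemma V_jacobi a b c d :
    c = 0 \/ p = -1 -> d = 0 \/ (alpha, beta) = (p, 0) ->
  forall x y h, jacobi (B_bracket alpha beta p) (V_action a b c d) x y h.
Proof.
move=> hc hd x y h; rewrite -[h]mulr1 -[h * 1]/(h *: (1 : {poly F}^o)).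
pose w i := if i == 0%N then d else 0.
have VL i n : V_action a b c d (B_L F i) 1 n
    = affine_coef (affL a b c i).1.1 (affL a b c i).1.2 (affL a b c i).2 n *: (1 : {poly F}^o).
  rewrite V_actionL -coef_affine [RHS]mulr1; congr (nth 0 (polyseq _) n).
  by case: i => [|[|i]] /=; rewrite ?polyC0; ring.
have VW i n : V_action a b c d (B_W F i) 1 n = affine_coef 0 0 (w i) n *: (1 : {poly F}^o).
  rewrite V_actionW -coef_affine [RHS]mulr1; congr (nth 0 (polyseq _) n).
  by rewrite /ker_actW /w; case: eqP => _; rewrite ?polyC0; ring.
have WW i j n : B_bracket alpha beta p (B_W F i) (B_W F j) n = affine_coef 0 0 0 n *: B_W F (i + j).
  by rewrite B_bracketWW affine_coef0 scale0r.
have w0 (d0 : d = 0) k : w k = 0 by rewrite /w d0 if_same.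
have AJ := affine_jacobi (br := B_bracket alpha beta p) (V_product a b c d).
apply: (B_jacobi_gen (V_product a b c d)) => i j.
- apply: AJ => [n|n|n|n|n|n||||]; rewrite ?(VL, VW, B_bracketLL) //;
  case: i => [|[|i]]; case: j => [|[|j]];
  rewrite ?(addSn, addnS, addn0, add0n) /= ?natrD; case: hc => hc; rewrite ?hc; split;
  rewrite ?(mulr0, mul0r, addr0, subr0, oppr0, subrr, add0r) //; ring.
- apply: AJ => [n|n|n|n|n|n||||]; rewrite ?(VL, VW, B_bracketLW) //; case: hd => [hd|[ha hb]];
    first [by rewrite ?(w0 hd); split; ring
          |by rewrite ?ha ?hb /w; case: i => [|[|i]]; case: j => [|[|j]];
              rewrite ?(addSn, addnS, addn0, add0n) /=; split; ring].
- apply: AJ => [n|n|n|n|n|n||||]; rewrite ?(VL, VW, B_bracketWL) //; case: hd => [hd|[ha hb]];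
    first [by rewrite ?(w0 hd); split; ring
          |by rewrite ?ha ?hb /w; case: i => [|[|i]]; case: j => [|[|j]];
              rewrite ?(addSn, addnS, addn0, add0n) /=; split; ring].
- apply: AJ => [n|n|n|n|n|n||||]; rewrite ?(VL, VW, WW) //;
  split; ring.
Qed.

End RankOneModules.

Section ModulesOverB.
Context (F : fieldType) (alpha beta p : F).

Definition V_ab (a b : F) : conformal_module (frakB alpha beta p) :=
  @ConformalModule F (frakB alpha beta p) _ _ (V_product p a b 0 0)
    (V_jacobi _ _ (or_introl erefl) (or_introl erefl)).

Definition V_abd (h : (alpha, beta) = (p, 0)) (a b d : F) :
    conformal_module (frakB alpha beta p) :=
  @ConformalModule F (frakB alpha beta p) _ _ (V_product p a b 0 d)
    (V_jacobi _ _ (or_introl erefl) (or_intror h)).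

Definition V_abc (hp : p = -1) (a b c : F) : conformal_module (frakB alpha beta p) :=
  @ConformalModule F (frakB alpha beta p) _ _ (V_product p a b c 0)
    (V_jacobi _ _ (or_intror hp) (or_introl erefl)).

Definition V_abcd (hp : p = -1) (h : (alpha, beta) = (-1, 0)) (a b c d : F) :
    conformal_module (frakB alpha beta p) :=
  @ConformalModule F (frakB alpha beta p) _ _ (V_product p a b c d)
    (V_jacobi _ _ (or_intror hp) (or_intror (etrans h (congr1 (pair^~ 0) (esym hp))))).

End ModulesOverB.

(* Main.v *)
Require Import Defs.
From HB Require Import structures.
From mathcomp Require Import all_boot all_order all_algebra.
From mathcomp Require Import reals complex.
From mathcomp Require Import zify ring finmap.
From mathcomp Require Import boolp classical_sets functions cardinality.
Import GRing.Theory.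
Import Num.Theory.
Local Open Scope ring_scope.
Set Implicit Arguments.
Unset Strict Implicit.
Unset Printing Implicit Defensive.

(* Let L_i(n), W_i(n) be the n-th products acting on V. If N is minimal such that
   some nonzero vectors are killed by all operators of degree at least N (for a
   suitable degree), then a relation between such vectors over C[D] only sees
   its leading terms, so these vectors form a space whose dimension is at most
   the number of generators of V. For the modes of L_0 alone this yields an
   eigenvector of T = D - L_0(0)/p, which commutes with all L_i(n) and whose
   eigenvalues are shifted by the W_i(n); hence T is a scalar, and W acts by
   zero unless beta = 0. It also yields an eigenvector v of L_0(1) killed by
   L_0(n) for n >= 2. Since the eigenspaces of L_0(1) have bounded dimension, a
   Dedekind-style independence argument for the vectors L_i(n) v shows that
   L_i and W_i kill v for all but finitely many i. So the minimal degree
   argument applies to all L_i and W_i at once, with L_i(n) of degree n + i and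
   W_i(n) of degree n + i + 1. On the resulting finite-dimensional space the
   operators of top degree are nilpotent, which forces those of degree at least
   2 to vanish; a common eigenvector of L_0(1), L_1(0) and W_0(0) then generates
   V over C[D]. *)

(** * Operators on subspaces of bounded dimension *)

Section Subspaces.
Context (F : numClosedFieldType) (U : lmodType F).
Implicit Types (S : U -> Prop) (f x y h : {linear U -> U}).

Record subspace S : Prop := Subspace {
  subspace0 : S 0;
  subspaceD : forall u v, S u -> S v -> S (u + v);
  subspaceZ : forall (c : F) u, S u -> S (c *: u) }.

Definition stable f S : Prop := forall u, S u -> S (f u).

Definition nonzero S : Prop := exists2 u, S u & u != 0.

(** The bound is put as a linear dependence of [r.+1] vectors because this is what the leading terms
    of a relation over C[D] provide. *)
Definition dim_le r S : Prop :=
  forall x : 'I_r.+1 -> U, (forall k, S (x k)) ->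
    exists2 c : 'I_r.+1 -> F, exists k, c k != 0 & \sum_k c k *: x k = 0.

Lemma subspaceB S u v : subspace S -> S u -> S v -> S (u - v).
Proof.
by move=> hS Su Sv; apply: (subspaceD hS Su); rewrite -scaleN1r; apply: (subspaceZ hS).
Qed.

Lemma subspace_sum S (I : Type) (s : seq I) (P : pred I) (g : I -> U) :
  subspace S -> (forall i, P i -> S (g i)) -> S (\sum_(i <- s | P i) g i).
Proof.
by move=> hS hg; apply: big_ind => //; [exact: subspace0 | exact: subspaceD].
Qed.

Lemma stable_iter S f n u : stable f S -> S u -> S (iter n f u).
Proof. by move=> hf Su; elim: n => //= n; apply: hf. Qed.

Lemma subspace_ker S f (e : F) : subspace S -> subspace (fun u => S u /\ f u = e *: u).
Proof.
move=> hS; split; first by rewrite linear0 scaler0; split=> //; apply: subspace0.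
- by move=> u v [Su ku] [Sv kv]; rewrite linearD ku kv scalerDr; split=> //; apply: subspaceD.
- move=> c u [Su ku]; rewrite linearZ /= ku !scalerA mulrC; split=> //.
  exact: subspaceZ.
Qed.

Lemma dim_le_sub r S S' : (forall u, S' u -> S u) -> dim_le r S -> dim_le r S'.
Proof. by move=> h hS x hx; apply: hS => k; apply: h. Qed.

(** Applying [f - e i0] kills the first term and multiplies the others by nonzero factors. The terms
    may themselves be sums, so the lemma also splits a relation by eigenvalues. *)
Lemma eigenvectors_independent (I : eqType) (s : seq I) (e : I -> F) (g : I -> U) f :
    uniq s -> {in s &, injective e} -> {in s, forall i, f (g i) = e i *: g i} ->
  \sum_(i <- s) g i = 0 -> {in s, forall i, g i = 0}.
Proof.
elim: s g => [//|i0 s IH] g /= /andP[i0s us] ie fe.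
rewrite big_cons => sum0.
have tail0 : {in s, forall i, g i = 0}.
  move=> i si; suff: (e i - e i0) *: g i = 0.
    move/eqP; rewrite scaler_eq0 => /orP[|/eqP//].
    rewrite subr_eq0 => /eqP /ie; rewrite !inE eqxx si orbT => /(_ isT isT) ii0.
    by rewrite -ii0 si in i0s.
  apply: (IH (fun i => (e i - e i0) *: g i)) si => //.
  - by move=> a b sa sb; apply: ie; rewrite inE ?sa ?sb orbT.
  - by move=> j sj; rewrite linearZ /= fe ?inE ?sj ?orbT // !scalerA mulrC.
  - transitivity (f (g i0 + \sum_(j <- s) g j) - e i0 *: (g i0 + \sum_(j <- s) g j)).
      rewrite linearD /= fe ?mem_head // scalerDr opprD addrACA subrr add0r.
      rewrite linear_sum scaler_sumr -sumrB; apply: eq_big_seq => j sj.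
      by rewrite fe ?inE ?sj ?orbT // scalerBl.
    by rewrite sum0 linear0 scaler0 subrr.
move=> i; rewrite inE => /orP[/eqP->|]; last exact: tail0.
by move: sum0; rewrite big1_seq ?addr0 // => j /andP[_ /tail0].
Qed.

(** The first [r.+1] iterates of [f] on a nonzero vector are dependent, so some nonzero polynomial
    in [f] kills it. Linear factors are split off: either [X - e] already kills the vector, or its
    image is a nonzero vector killed by the quotient. *)
Lemma ex_eigenvector r S f :
  subspace S -> dim_le r S -> stable f S -> nonzero S ->
  exists (e : F) u, [/\ S u, u != 0 & f u = e *: u].
Proof.
move=> hS hr hf [u Su u0].
pose act (q : {poly F}) v := \sum_(i < size q) q`_i *: iter i f v.
have actE (q : {poly F}) v n : (size q <= n)%N -> act q v = \sum_(i < n) q`_i *: iter i f v.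
  move=> hn; rewrite /act (big_ord_widen n (fun i => q`_i *: iter i f v)) // big_mkcond.
  apply: eq_bigr => i _; case: ltnP => // hi.
  by rewrite nth_default // scale0r.
have [c [k ck] cu] := hr (fun k => iter k f u) (fun k => stable_iter k hf Su).
pose q := \poly_(i < r.+1) c (inord i).
have q0 : q != 0.
  apply/eqP => /(congr1 (fun q : {poly F} => q`_k)).
  by rewrite coef_poly ltn_ord inord_val coef0 => /eqP; rewrite (negPf ck).
have qu : act q u = 0.
  rewrite (actE _ _ _ (size_poly _ _)) -[RHS]cu; apply: eq_bigr => i _.
  by rewrite coef_poly ltn_ord inord_val.
clearbody q; have [n hq] : exists n, (size q <= n)%N by exists (size q).
elim: n q u Su u0 q0 qu hq {c k ck cu} => [|n IH] q v Sv v0 q0 qv hq.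
  by move: hq q0; rewrite leqn0 size_poly_eq0 => /eqP->; rewrite eqxx.
have [szq|szq] := leqP (size q) 1.
  have q00 : q`_0 != 0 by rewrite -polyC_eq0 -size1_polyC.
  move: qv; rewrite (actE _ _ 1%N) // big_ord1 /=.
  by move/eqP; rewrite scaler_eq0 (negPf q00) (negPf v0).
have /closed_rootP [e /factor_theorem [q1 qE]] : size q != 1%N by rewrite gtn_eqF.
have q10 : q1 != 0 by apply: contraNneq q0 => q10; rewrite qE q10 mul0r.
have [fe|fe] := eqVneq (f v - e *: v) 0.
  by exists e, v; split=> //; apply/eqP; rewrite -subr_eq0 fe.
have sz1 : size q = (size q1).+1 by rewrite qE size_Mmonic ?monicXsubC // size_XsubC addn2.
have Sfe : S (f v - e *: v) by apply: subspaceB => //; [exact: hf | exact: subspaceZ].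
apply: (IH q1 _ Sfe) => //; last by rewrite -ltnS -sz1.
rewrite -qv (actE q _ (size q1).+1) ?sz1 // qE.
have -> : act q1 (f v - e *: v) =
    \sum_(i < size q1) q1`_i *: iter i.+1 f v - e *: \sum_(i < size q1) q1`_i *: iter i f v.
  rewrite scaler_sumr -sumrB; apply: eq_bigr => i _.
  have -> : iter i f (f v - e *: v) = iter i.+1 f v - e *: iter i f v.
    elim: (nat_of_ord i) => //= j ->; rewrite linearB linearZ //.
  by rewrite scalerBr !scalerA mulrC.
rewrite -/(act q1 v) (actE q1 v (size q1).+1) // scaler_sumr.
under [RHS]eq_bigr do rewrite mulrBr coefB coefMX coefMC scalerBl.
rewrite sumrB; congr (_ - _); first by rewrite [RHS]big_ord_recl /= scale0r add0r.
by apply: eq_bigr => i _; rewrite scalerA mulrC.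
Qed.

(* h shifts the eigenvalues of x by c, so h is nilpotent on the eigenvectors of x. *)
Lemma ex_ker_shift r S x h (c : F) :
    subspace S -> dim_le r S -> stable x S -> stable h S -> nonzero S -> c != 0 ->
    (forall u, S u -> x (h u) - h (x u) = c *: h u) ->
  exists u, [/\ S u, u != 0 & h u = 0].
Proof.
move=> hS hr Sx Sh S0 c0 xh.
have [e [u [Su u0 xu]]] := ex_eigenvector hS hr Sx S0.
apply: contrapT => noker.
have it0 k : iter k h u != 0.
  elim: k => //= k IH; apply/eqP => hk; apply: noker.
  by exists (iter k h u); split=> //; apply: stable_iter.
have xit k : x (iter k h u) = (e + c *+ k) *: iter k h u.
  elim: k => [|k IH] /=; first by rewrite mulr0n addr0.
  have /eqP := xh _ (stable_iter k Sh Su).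
  rewrite subr_eq IH linearZ /= -scalerDl => /eqP ->; congr (_ *: _).
  by rewrite mulrS; ring.
have [b [k bk] bu] := hr (fun k => iter k h u) (fun k => stable_iter k Sh Su).
have := @eigenvectors_independent _ (index_enum 'I_r.+1) (fun k => e + c *+ k)
  (fun k => b k *: iter k h u) x (index_enum_uniq _).
move=> /(_ _ _ bu k); rewrite mem_index_enum => H.
suff: b k *: iter k h u = 0 by move/eqP; rewrite scaler_eq0 (negPf bk) (negPf (it0 k)).
apply: H => //.
  move=> i j _ _ /addrI /eqP; rewrite -[c *+ i]mulr_natr -[c *+ j]mulr_natr.
  rewrite (inj_eq (mulfI c0)) eqr_nat => /eqP.
  exact: val_inj.
by move=> i _; rewrite linearZ /= xit !scalerA mulrC.
Qed.

(** While the exponent exceeds [r], it can be lowered by one: in a relation among the first [r.+1]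
    iterates, a suitable power of [f] kills every term but the one of least index. *)
Lemma nilpotent_bound r S f n u :
  dim_le r S -> stable f S -> S u -> iter n f u = 0 -> iter r f u = 0.
Proof.
move=> hr Sf Su; have [|] := leqP n r.
  move=> /subnK <- fn; rewrite iterD fn; elim: (r - n)%N => //= k ->; exact: linear0.
elim: n => // n IH; rewrite ltnS => rn fn.
have [fn0|] := eqVneq (iter n f u) 0.
  by move: rn; rewrite leq_eqVlt => /orP[/eqP -> //|/IH]; apply.
have [c [k ck] cu] := hr (fun k => iter k f u) (fun k => stable_iter k Sf Su).
have /(_ ck) := @arg_minnP _ k (fun i => c i != 0) (fun i : 'I_r.+1 => i : nat).
case=> {ck} {}k ck kmin.
have itL j v w (a : F) : iter j f (a *: v + w) = a *: iter j f v + iter j f w.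
  by elim: j => //= j ->; rewrite linearD linearZ.
have it0 j : iter j f 0 = 0 by elim: j => //= j ->; rewrite linear0.
move/(congr1 (iter (n - k) f)): cu; rewrite it0 (bigD1 k) //= itL -iterD subnK; last first.
  by apply: leq_trans rn; rewrite -ltnS.
have -> : iter (n - k) f (\sum_(i | i != k) c i *: iter i f u) = 0.
  apply: (big_ind (fun w => iter (n - k) f w = 0)) => // [v w hv hw|i ik].
    by rewrite -[v]scale1r itL hv hw scaler0 addr0.
  have [c0|/kmin ki] := eqVneq (c i) 0; first by rewrite c0 scale0r.
  have {}ki : (k < i)%N by rewrite ltn_neqAle ki eq_sym andbT.
  rewrite -[_ *: _]addr0 itL it0 addr0 -iterD.
  have -> : (n - k + i = (i - k).-1 + n.+1)%N.
    by have := ltn_ord i; lia.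
  by rewrite iterD fn it0 scaler0.
rewrite addr0 => /eqP; rewrite scaler_eq0 (negPf ck) /= => /eqP fn0 /eqP.
by rewrite fn0.
Qed.

Lemma iter_linear f n : linear (iter n f).
Proof. by move=> c u v; elim: n => //= n ->; rewrite linearP. Qed.

Lemma iter_sum f n (I : Type) (s : seq I) (P : pred I) (g : I -> U) :
  iter n f (\sum_(i <- s | P i) g i) = \sum_(i <- s | P i) iter n f (g i).
Proof. by elim: n => //= n ->; rewrite linear_sum. Qed.

Lemma iter_scale f n (c : F) u : iter n f (c *: u) = c *: iter n f u.
Proof. by elim: n => //= n ->; rewrite linearZZ. Qed.

(** * Nilpotency of commutators that commute with one of their factors *)

Section Jacobson.
Context (S : U -> Prop) (x y h : {linear U -> U}) (c : F).
Context (Sx : stable x S) (Sy : stable y S) (Sh : stable h S).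
Context (xy : forall u, S u -> x (y u) - y (x u) = c *: h u).
Context (xh : forall u, S u -> x (h u) = h (x u)).

Lemma iter_commute m a u : S u -> iter m x (iter a h u) = iter a h (iter m x u).
Proof.
move=> Su; elim: m => //= m ->.
elim: a => //= a IH; rewrite xh ?IH //.
by apply: stable_iter Sh _; apply: stable_iter Sx Su.
Qed.

Lemma iter_commutator m u : S u ->
  iter m.+1 x (y u) = y (iter m.+1 x u) + (m.+1%:R * c) *: iter m x (h u).
Proof.
move=> Su; elim: m => [|m IH]; first by rewrite mul1r /= -xy // addrC subrK.
have -> : iter m.+2 x (y u) = x (iter m.+1 x (y u)) by [].
have hE := iter_commute m.+1 1 Su; rewrite IH linearD linearZ /= in hE *.
rewrite hE -[x (y _)](subrK (y (x (x (iter m x u))))).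
rewrite (xy (stable_iter m.+1 Sx Su)) /= addrC addrA addrC; congr (_ + _).
by rewrite -scalerDl [m.+2%:R]mulrS mulrDl mul1r addrC.
Qed.

(* Kaplansky: x^m h^a = 0 implies h^a x^m y h^a = m c x^(m-1) h^(2a+1), which
   lowers m. *)
Lemma commutator_nilpotent n : c != 0 -> (forall u, S u -> iter n x u = 0) ->
  exists a, forall u, S u -> iter a h u = 0.
Proof.
move=> c0; suff H a : (forall u, S u -> iter n x (iter a h u) = 0) ->
    exists a, forall u, S u -> iter a h u = 0 by move=> hn; apply: (H 0%N).
elim: n a => [|n IH] a hn; first by exists a.
apply: (IH (a + a).+1) => u Su; have Sa := stable_iter a Sh Su.
have h0 : iter a h 0 = 0 by elim: (a) => //= k ->; rewrite linear0.
have := iter_commutator n Sa; rewrite hn // linear0 add0r => /(congr1 (iter a h)).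
rewrite -iter_commute ?hn //; try exact: Sy.
have -> : iter a h ((n.+1%:R * c) *: iter n x (h (iter a h u)))
    = (n.+1%:R * c) *: iter a h (iter n x (h (iter a h u))).
  by rewrite -[_ *: _ in LHS]addr0 iter_linear h0 addr0.
rewrite -iter_commute; last exact: Sh.
have -> : iter a h (h (iter a h u)) = iter (a + a).+1 h u.
  by rewrite -addnS (iterD a a.+1).
by move/esym/eqP; rewrite scaler_eq0 mulf_eq0 pnatr_eq0 (negPf c0) => /eqP.
Qed.
End Jacobson.

(** Take an eigenvector [w] of [x], of eigenvalue [f], inside the [e]-eigenspace of [h]. On the
    generalised [f]-eigenspace of [x] the operator [n = x - f] is nilpotent, hence so is [h] by
    [commutator_nilpotent]; applied to [w] this gives a power of [e] equal to 0. *)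
Lemma commutator_eigenvalue r S x y h (c e : F) u :
    subspace S -> dim_le r S -> stable x S -> stable y S -> stable h S ->
    (forall u, S u -> x (y u) - y (x u) = c *: h u) ->
    (forall u, S u -> x (h u) = h (x u)) -> c != 0 ->
  S u -> u != 0 -> h u = e *: u -> e = 0.
Proof.
move=> hS hr Sx Sy Sh xy xh c0 Su u0 hu.
have [||||f [w [[Sw hw] w0 xw]]] := @ex_eigenvector r (fun v => S v /\ h v = e *: v) x.
- exact: subspace_ker.
- by apply: dim_le_sub hr => v [].
- by move=> v [Sv hv]; split; [exact: Sx | rewrite -xh // hv linearZ].
- by exists u.
pose n : {linear U -> U} := x \- f \*: idfun.
have nE v : n v = x v - f *: v by [].
clearbody n.
have Sn : stable n S by move=> v Sv; rewrite nE; apply: subspaceB; [|exact: Sx|exact: subspaceZ].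
have ny v : S v -> n (y v) - y (n v) = c *: h v.
  by move=> Sv; rewrite -xy // !nE linearB [y (f *: _)]linearZZ opprB addrA subrK.
have nh v : S v -> n (h v) = h (n v) by move=> Sv; rewrite !nE xh // linearB [h (f *: _)]linearZZ.
have n0 k : iter k n 0 = 0 by elim: k => //= k ->; rewrite linear0.
pose G v := S v /\ exists k, iter k n v = 0.
have Gr v : G v -> iter r n v = 0 by case=> Sv [k]; apply: nilpotent_bound hr Sn Sv.
have Gn : stable n G.
  by move=> v [Sv [k kv]]; split; [exact: Sn | exists k; rewrite -iterSr iterS kv linear0].
have Gh : stable h G.
  move=> v [Sv [k kv]]; split; first exact: Sh.
  by exists k; rewrite (iter_commute Sn Sh nh k 1) //= kv linear0.
(* By [iter_commutator], [y] may cost one more power of [n]. This is why [G] allows any exponent;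
   [Gr] then makes the exponent uniform. *)
have Gy : stable y G.
  move=> v [Sv [k kv]]; split; first exact: Sy.
  exists k.+1; rewrite (iter_commutator Sn Sh ny nh) // (iter_commute Sn Sh nh k 1) //= kv.
  by rewrite !linear0 ?scaler0 addr0.
have [||a ha] := commutator_nilpotent Gn Gy Gh _ _ c0 Gr.
- by move=> v [Sv _]; apply: ny.
- by move=> v [Sv _]; apply: nh.
have Gw : G w by split=> //; exists 1%N; rewrite /= nE xw subrr.
have itw k : iter k h w = e ^+ k *: w.
  by elim: k => [|k /= ->]; rewrite ?scale1r // linearZ /= hw scalerA exprSr.
have /eqP := ha w Gw; rewrite itw scaler_eq0 (negPf w0) orbF expf_eq0.
by case/andP => _ /eqP.
Qed.

(** An eigenvector of [h] in [S'] has eigenvalue 0. Only [h] has to preserve [S'], while [x] and [y]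
    live on the larger space [S]. *)
Lemma ex_ker_commutator r S S' x y h (c : F) :
    subspace S -> dim_le r S -> stable x S -> stable y S -> stable h S ->
    (forall u, S u -> x (y u) - y (x u) = c *: h u) ->
    (forall u, S u -> x (h u) = h (x u)) -> c != 0 ->
    subspace S' -> stable h S' -> nonzero S' -> (forall u, S' u -> S u) ->
  exists u, [/\ S' u, u != 0 & h u = 0].
Proof.
move=> hS hr Sx Sy Sh xy xh c0 hS' Sh' n0 sub.
have [e [u [S'u u0 hu]]] := ex_eigenvector hS' (dim_le_sub sub hr) Sh' n0.
exists u; split=> //; rewrite hu.
by rewrite (commutator_eigenvalue hS hr Sx Sy Sh xy xh c0 (sub _ S'u) u0 hu) scale0r.
Qed.

End Subspaces.

(** * Modules over the algebra of modes *)

Lemma scale_eq0_coef (F : fieldType) (U : lmodType F) (c : F) (u : U) :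
  u != 0 -> c *: u = 0 -> c = 0.
Proof. by move=> u0 /eqP; rewrite scaler_eq0 (negPf u0) orbF => /eqP. Qed.

Section ModeModules.
Context (F : numClosedFieldType) (alpha beta p : F) (U : lmodType F).

Definition shift (d : {linear U -> U}) (g : F) : {linear U -> U} := d \- g \*: idfun.

(* L i n and W i n are the n-th products, i.e. n! times the coefficients of
   lambda^n, of L_i and W_i acting on U, and d is the action of partial. *)
Record mode_module (r : nat) (d : {linear U -> U}) (L W : nat -> nat -> {linear U -> U}) :
    Prop := ModeModule {
  mm_LL : forall i j m n u, L i m (L j n u) - L j n (L i m u)
    = ((j%:R + p) * m%:R - (i%:R + p) * n%:R) *: L (i + j)%N (m + n).-1 u;
  mm_LW : forall i j m n u, L i m (W j n u) - W j n (L i m u)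
    = ((j%:R + alpha - p) * m%:R - (i%:R + p) * n%:R) *: W (i + j)%N (m + n).-1 u
      + ((i%:R + p) * beta) *: W (i + j)%N (m + n)%N u;
  mm_WW : forall i j m n u, W i m (W j n u) = W j n (W i m u);
  mm_dL : forall i n u, d (L i n u) - L i n (d u) = - (n%:R *: L i n.-1 u);
  mm_dW : forall i n u, d (W i n u) - W i n (d u) = - (n%:R *: W i n.-1 u);
  mm_finL : forall i u, exists N, forall n, (N <= n)%N -> L i n u = 0;
  mm_finW : forall i u, exists N, forall n, (N <= n)%N -> W i n u = 0;
  mm_rank : forall g (x : 'I_r.+1 -> U), exists m (c : 'I_r.+1 -> nat -> F),
    (exists k, c k m != 0) /\
    \sum_(e < m.+1) iter e (shift d g) (\sum_k c k e *: x k) = 0;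
  mm_irr : forall S, subspace S -> stable d S -> (forall i n, stable (L i n) S) ->
    (forall i n, stable (W i n) S) -> nonzero S -> forall u, S u;
  mm_nontriv : ~ (forall i n u, L i n u = 0 /\ W i n u = 0) }.

Context (r : nat) (d : {linear U -> U}) (L W : nat -> nat -> {linear U -> U}).
Context (H : mode_module r d L W).

(** These are the relations between the modes of a Virasoro field and those of a primary field, with
    weight encoded by [s]. The extra term [g] comes from beta: it is 0 for [L i] and [p * beta] for
    [W i]. *)
Record primary (A : nat -> {linear U -> U}) (s g : F) : Prop := Primary {
  pr_d : forall n u, d (A n u) - A n (d u) = - (n%:R *: A n.-1 u);
  pr_L0 : forall m n u, L 0 m (A n u) - A n (L 0 m u)
    = (s * m%:R - p * n%:R) *: A (m + n).-1 u + g *: A (m + n)%N u;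
  pr_fin : forall u, exists N, forall n, (N <= n)%N -> A n u = 0 }.

Lemma primaryL i : primary (L i) (i%:R + p) 0.
Proof.
split=> [n u|m n u|u]; [exact: mm_dL H _ _ _ | | exact: mm_finL H _ _].
by rewrite (mm_LL H) add0r scale0r addr0 add0n.
Qed.

Lemma primaryW i : primary (W i) (i%:R + alpha - p) (p * beta).
Proof.
split=> [n u|m n u|u]; [exact: mm_dW H _ _ _ | | exact: mm_finW H _ _].
by rewrite (mm_LW H) add0r add0n.
Qed.

Lemma primary_top A s g u : primary A s g -> ~ (forall n, A n u = 0) ->
  exists t, A t u != 0 /\ forall n, (t < n)%N -> A n u = 0.
Proof.
move=> hA /existsNP [n /eqP An0]; have [N hN] := pr_fin hA u.
have [|t t0 tmax] := @ex_maxnP (fun n => A n u != 0) N (ex_intro _ n An0).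
  by move=> i; apply: contraR; rewrite -ltnNge => /ltnW /hN ->.
by exists t; split=> // k tk; apply: contraTeq tk => /tmax; rewrite -leqNgt.
Qed.

Lemma primary_comm_d A s g n u : primary A s g -> A n (d u) = d (A n u) + n%:R *: A n.-1 u.
Proof. by move=> hA; rewrite -[n%:R *: _]opprK -(pr_d hA) opprB addrC subrK. Qed.

Lemma primary_comm_shift A s g e n u : primary A s g ->
  A n (shift d e u) = shift d e (A n u) + n%:R *: A n.-1 u.
Proof.
move=> hA; rewrite /shift /= linearB linearZZ (primary_comm_d _ _ hA).
by rewrite addrAC.
Qed.

Lemma primary_comm_L0 A s g m n u : primary A s g ->
  L 0 m (A n u) = A n (L 0 m u) + (s * m%:R - p * n%:R) *: A (m + n).-1 u + g *: A (m + n)%N u.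
Proof. by move=> hA; rewrite -addrA -(pr_L0 hA) addrC subrK. Qed.

(** Moving [A n] past D leaves [n A (n-1)], so each factor D - e raises the last possible mode by
    one; the factors n multiply up to a falling factorial. *)
Lemma top_shift_iter A s g e t u j : primary A s g -> (forall n, (t < n)%N -> A n u = 0) ->
  A (t + j)%N (iter j (shift d e) u) = ((t + j) ^_ j)%:R *: A t u /\
  (forall n, (t + j < n)%N -> A n (iter j (shift d e) u) = 0).
Proof.
move=> hA top; elim: j => [|j [IH1 IH2]]; first by rewrite addn0 ffactn0 scale1r.
rewrite addnS /=; split=> [|n tn]; rewrite (primary_comm_shift _ _ _ hA).
  by rewrite IH2 // linear0 add0r IH1 scalerA -natrM -ffactSS.
rewrite !IH2 ?linear0 ?scaler0 ?addr0 //; lia.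
Qed.

(* A_{t+m} applied to the relation only sees its leading term. *)
Lemma top_relation A s g e t m (z : nat -> U) : primary A s g ->
    (forall j n, (t < n)%N -> A n (z j) = 0) ->
  \sum_(j < m.+1) iter j (shift d e) (z j) = 0 -> A t (z m) = 0.
Proof.
move=> hA top /(congr1 (A (t + m)%N)); rewrite linear0 linear_sum big_ord_recr /= big1 => [|j _].
  rewrite (top_shift_iter e m hA (top m)).1 add0r => /eqP.
  rewrite scaler_eq0 pnatr_eq0 -leqn0 leqNgt ffact_gt0 leq_addl /=.
  by move/eqP.
by apply: (top_shift_iter e j hA (top j)).2; rewrite ltn_add2l.
Qed.

(** * Vectors killed by all operators of large degree *)

Section Filtration.
Context (I : Type) (A : I -> nat -> {linear U -> U}) (s g : I -> F) (o : I -> nat).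
Context (hA : forall i, primary (A i) (s i) (g i)).

Definition annihilated N u : Prop := forall i n, (N <= n + o i)%N -> A i n u = 0.

Lemma annihilated_subspace N : subspace (annihilated N).
Proof.
split=> [i n _|v w Sv Sw i n h|c v Sv i n h]; first exact: linear0.
  by rewrite linearD Sv // Sw // addr0.
by rewrite linearZZ Sv // scaler0.
Qed.

(** Take a relation over C[D] among [r.+1] such vectors. By [top_relation] the combination of its
    leading coefficients is killed by degree [N] as well, hence is zero. *)
Lemma annihilated_dim_le N : (forall u, annihilated N u -> u = 0) -> dim_le r (annihilated N.+1).
Proof.
move=> h0 x hx; have [m [c [[k ck] rel]]] := mm_rank H 0 x.
exists (fun k => c k m); first by exists k.
have hz e : annihilated N.+1 (\sum_k c k e *: x k).
  apply: subspace_sum => [|i _]; first exact: annihilated_subspace.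
  by apply: (subspaceZ (annihilated_subspace _)); apply: hx.
apply: h0 => i n hn.
apply: (top_relation (z := fun e => \sum_k c k e *: x k) (hA i) _ rel) => e n' hn'.
by apply: (hz e i n'); lia.
Qed.

Lemma ex_min_annihilated N : (forall u, annihilated 0 u -> u = 0) -> nonzero (annihilated N) ->
  exists n, [/\ (forall u, annihilated n u -> u = 0), nonzero (annihilated n.+1) &
    dim_le r (annihilated n.+1)].
Proof.
move=> h0; elim: N => [|N IH] hN; first by case: hN => u /h0 ->; rewrite eqxx.
have [/IH //|hN0] := pselect (nonzero (annihilated N)).
have zN u : annihilated N u -> u = 0.
  by move=> hu; apply: contrapT => /eqP u0; apply: hN0; exists u.
by exists N; split=> //; apply: annihilated_dim_le.
Qed.
End Filtration.

(** * Vectors killed by L_0, and freeness over C[D] *)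

Context (p0 : p != 0).

(** Evaluating [L_0(0), L_0(2)] = -2p L_0(1) at [A t u] gives p (t + 1) (2 s - p t) = 0. *)
Lemma L0_kernel_top A s g t u : primary A s g -> (forall n, L 0 n u = 0) ->
  A t u != 0 -> (forall n, (t < n)%N -> A n u = 0) -> 2 * s = p * t%:R.
Proof.
move=> hA Lu t0 top; have L0A m n := primary_comm_L0 m n u hA.
have E0 : L 0 0 (A t u) = (- (p * t%:R)) *: A t.-1 u + g *: A t u.
  by rewrite L0A Lu linear0 add0r mulr0 sub0r add0n.
have E1 : L 0 1 (A t u) = (s - p * t%:R) *: A t u.
  by rewrite L0A Lu linear0 add0r mulr1 add1n /= [A t.+1 u]top // scaler0 addr0.
have E2 : L 0 2 (A t u) = 0.
  by rewrite L0A Lu linear0 add0r !top ?scaler0 ?addr0.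
(* The factor [t%:R] covers [t = 0], where [t.-1] is again 0. *)
have E3 : t%:R *: L 0 2 (A t.-1 u) = (t%:R * (s * 2 - p * (t%:R - 1))) *: A t u.
  case: (t) top => [|t'] top /=; first by rewrite mul0r !scale0r.
  rewrite L0A Lu linear0 add0r add2n /= [A t'.+2 u]top // scaler0 addr0 scalerA.
  by rewrite [t'.+1%:R]mulrS addrAC subrr add0r.
have := mm_LL H 0 0 0 2 (A t u).
rewrite E2 E0 E1 linear0 linearD ![L 0 2 (_ *: _)]linearZZ E2 scaler0 addr0.
rewrite scaleNr -[(p * _) *: _]scalerA E3 sub0r opprK !scalerA => /eqP.
rewrite -subr_eq0 -scalerBl => /eqP /(scale_eq0_coef t0) E.
have : p * ((t%:R + 1) * (2 * s - p * t%:R)) = 0 by rewrite -[RHS]E; ring.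
move/eqP; rewrite !mulf_eq0 (negPf p0) natr1 pnatr_eq0 subr_eq0 => /eqP.
by [].
Qed.

(** With [u] also [d u] is killed by L_0, and its last nonzero mode is one higher; 2 s = p t cannot
    hold for both t and t + 1. *)
Lemma L0_kernel_primary A s g u : primary A s g -> (forall n, L 0 n u = 0) ->
  forall n, A n u = 0.
Proof.
move=> hA Lu; apply: contrapT => /(primary_top hA) [t [t0 top]].
have Ldu n : L 0 n (d u) = 0.
  by rewrite (primary_comm_d _ _ (primaryL 0)) !Lu linear0 scaler0 addr0.
have e1 := L0_kernel_top hA Lu t0 top.
have : 2 * s = p * t.+1%:R.
  apply: (L0_kernel_top hA Ldu).
    rewrite (primary_comm_d _ _ hA) top // linear0 add0r scaler_eq0 pnatr_eq0.
    exact: t0.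
  move=> n tn; rewrite (primary_comm_d _ _ hA) !top ?linear0 ?add0r ?scaler0 //; lia.
rewrite e1 => /(mulfI p0) /eqP; rewrite eqr_nat => /eqP; lia.
Qed.

(** The kernel of L_0 is killed by all L and W, hence is a submodule; if nonzero it would be
    everything and the action trivial. *)
Lemma L0_kernel u : (forall n, L 0 n u = 0) -> u = 0.
Proof.
move=> Lu; apply: contrapT => /eqP u0; apply: (mm_nontriv H).
pose S v := forall n, L 0 n v = 0.
have hS : subspace S.
  split=> [n|v w Sv Sw n|c v Sv n]; first exact: linear0.
    by rewrite linearD Sv Sw addr0.
  by rewrite linearZZ Sv scaler0.
have SL i n v : S v -> L i n v = 0 by move=> Sv; apply: (L0_kernel_primary (primaryL i)).
have SW i n v : S v -> W i n v = 0 by move=> Sv; apply: (L0_kernel_primary (primaryW i)).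
have all_S : forall v, S v.
  apply: (mm_irr H hS) => [v Sv n|i n v Sv|i n v Sv|]; last by exists u.
  - by rewrite (primary_comm_d _ _ (primaryL 0)) !Sv linear0 scaler0 addr0.
  - by rewrite SL //; apply: subspace0.
  - by rewrite SW //; apply: subspace0.
by move=> i n v; split; [apply: SL | apply: SW].
Qed.

Lemma shift_injective e u : shift d e u = 0 -> u = 0.
Proof.
move=> du; apply: L0_kernel; have hL := primaryL 0; apply: contrapT.
move=> /(primary_top hL) [t [t0 top]].
have := primary_comm_shift e t.+1 u hL; rewrite du linear0 top // linear0 add0r /=.
move/esym/eqP; rewrite scaler_eq0 pnatr_eq0 /=.
by rewrite (negPf t0).
Qed.

Lemma shift_iter_injective e n u : iter n (shift d e) u = 0 -> u = 0.
Proof. by elim: n => //= n IH /shift_injective. Qed.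

(** Torsion-freeness over C[D], for polynomials expanded at [e]: the last nonzero mode of L_0 on [u]
    detects the leading coefficient. *)
Lemma leading_coef_eq0 e m (c : nat -> F) u : u != 0 ->
  \sum_(j < m.+1) iter j (shift d e) (c j *: u) = 0 -> c m = 0.
Proof.
move=> u0 rel; have hL := primaryL 0.
have [Lu|t [t0 top]] := primary_top hL (u := u).
  by move/eqP: u0; case; apply: L0_kernel.
have zt j n : (t < n)%N -> L 0 n (c j *: u) = 0 by move=> tn; rewrite linearZZ top // scaler0.
have := top_relation (z := fun j => c j *: u) hL zt rel.
by rewrite linearZZ => /(scale_eq0_coef t0).
Qed.

Lemma ex_nonzero : exists u : U, u != 0.
Proof.
apply: contrapT => h; apply: (mm_nontriv H) => i n u.
have z (v : U) : v = 0 by apply: contrapT => /eqP v0; apply: h; exists v.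
by split; apply: z.
Qed.

(** * The operator T = D - L_0(0)/p and its eigenvalues *)

Definition twist : {linear U -> U} := d \- p^-1 \*: L 0 0.

Lemma twist_primary A s g n u : primary A s g ->
  twist (A n u) = A n (twist u) - (p^-1 * g) *: A n u.
Proof.
move=> hA; rewrite /twist /= linearB [A n (_ *: _)]linearZZ (primary_comm_d _ _ hA).
rewrite (primary_comm_L0 _ _ _ hA) mulr0 sub0r add0n !scalerDr !scalerA mulrN mulKf //.
by rewrite scaleNr !opprD opprK !addrA; congr (_ - _); rewrite addrAC.
Qed.

(** In Virasoro numbering L_0(m) has index m - 1, so the positive modes are the ones required to
    vanish. *)
Definition quasi_primary u : Prop := forall m, (2 <= m)%N -> L 0 m u = 0.

(** Let [S n.+1] be the first nonzero step of the filtration for L_0 alone. If n were at least 2,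
    L_0(n) would shift L_0(1)-eigenvalues on it by p (1 - n), hence kill a nonzero vector, which
    would lie in [S n]. *)
Lemma ex_quasi_primary : exists S, [/\ subspace S, dim_le r S, nonzero S &
  [/\ stable (L 0 1) S, stable twist S & forall u, S u -> quasi_primary u]].
Proof.
have hA (i : unit) := primaryL 0.
pose S := annihilated (fun _ : unit => L 0) (fun=> 0%N).
have SE n u : S n u <-> forall m, (n <= m)%N -> L 0 m u = 0.
  split=> [h m nm|h i m]; first by apply: (h tt); rewrite addn0.
  by rewrite addn0; apply: h.
have [u u0] := ex_nonzero; have [N hN] := mm_finL H 0 u.
have hN' : nonzero (S N) by exists u => //; apply/SE.
have [|n [n0 nz dimn]] := ex_min_annihilated hA _ hN'.
  by move=> v /SE h; apply: (L0_kernel) => m; apply: h.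
have sS k : subspace (S k) by apply: annihilated_subspace.
have S1 m : stable (L 0 m.+1) (S n.+1).
  move=> v /SE h; apply/SE => k nk; rewrite (primary_comm_L0 _ _ _ (primaryL 0)).
  by rewrite h // linear0 scale0r addr0 add0r h ?scaler0 // addnS /=; lia.
exists (S n.+1); split=> //; split=> //.
  move=> v /SE h; apply/SE => k nk; have := twist_primary k v (primaryL 0).
  rewrite (h k nk) linear0 scaler0 subr0.
  by [].
have n1 : (n <= 1)%N.
  rewrite leqNgt; apply/negP => n2.
  have Sn : stable (L 0 n) (S n.+1) by case: (n) n2 S1 => // n' _; apply.
  have c0 : p * (1 - n%:R) != 0.
    by rewrite mulf_neq0 // subr_eq0 (eqr_nat F 1) neq_ltn n2.
  have [v _|v [Sv v0 Lv]] := ex_ker_shift (sS _) dimn (S1 0) Sn nz c0.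
    by rewrite (mm_LL H) !add0r !add0n mulr1 mulrBr mulr1.
  move: v0; rewrite (n0 v) ?eqxx //; apply/SE => m; rewrite leq_eqVlt => /orP[/eqP <- //|].
  by move: m; apply/SE.
by move=> v /SE h m m2; apply: h; apply: leq_ltn_trans n1 m2.
Qed.

(** T commutes with D, so a relation over C[D] splits by eigenvalues of T into relations on single
    vectors, against torsion-freeness. *)
Lemma twist_eigenvalues (e : 'I_r.+1 -> F) (x : 'I_r.+1 -> U) :
  injective e -> (forall k, x k != 0) -> (forall k, twist (x k) = e k *: x k) -> False.
Proof.
move=> ie x0 ex; have [m [c [[k ck] rel]]] := mm_rank H 0 x.
pose z k j := c k j *: x k.
pose G k := \sum_(j < m.+1) iter j (shift d 0) (z k j).
have twist_shift j v (a : F) : twist v = a *: v ->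
    twist (iter j (shift d 0) v) = a *: iter j (shift d 0) v.
  elim: j => // j IH /IH {}IH; rewrite iterS.
  have d0 w : shift d 0 w = d w by rewrite /shift /= scale0r subr0.
  rewrite !d0; have -> w : twist (d w) = d (twist w).
    rewrite /twist /= linearB [d (_ *: _)]linearZZ; congr (_ - _ *: _); apply/eqP.
    by rewrite eq_sym -subr_eq0 (mm_dL H) scale0r oppr0.
  by rewrite IH linearZZ.
have sumG : \sum_k G k = 0.
  rewrite -[RHS]rel exchange_big; apply: eq_bigr => j _ /=.
  by rewrite iter_sum.
have Gk : G k = 0.
  apply: (@eigenvectors_independent _ _ _ (index_enum 'I_r.+1) e G twist);
    rewrite ?index_enum_uniq ?mem_index_enum //.
  - by move=> i j _ _; apply: ie.
  - move=> i _; rewrite linear_sum scaler_sumr; apply: eq_bigr => j _.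
    by apply: twist_shift; rewrite linearZZ ex !scalerA mulrC.
by move: ck; rewrite (leading_coef_eq0 (x0 k) Gk) eqxx.
Qed.

(** An eigenspace of T is stable under D and all L_i, so it is everything as soon as W preserves
    it. *)
Lemma twist_scalar : exists g, (forall u, L 0 0 u = p *: shift d g u) /\
  (beta = 0 \/ forall i n u, W i n u = 0).
Proof.
pose E g u := twist u = g *: u.
have sE g : subspace (E g).
  split; first by rewrite /E linear0 scaler0.
    by move=> u v Eu Ev; rewrite /E linearD Eu Ev scalerDr.
  by move=> c u Eu; rewrite /E linearZZ Eu !scalerA mulrC.
suff [g ng gW] : exists2 g, nonzero (E g) &
    (beta = 0 \/ forall i n u, E g u -> W i n u = 0).
  have allE : forall u, E g u.
    apply: (mm_irr H (sE g)) => // [u Eu|i n u Eu|i n u Eu].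
    - rewrite /E /twist /= in Eu *; rewrite -[g *: _]linearZZ -Eu linearB [d (_ *: _)]linearZZ.
      congr (_ - _ *: _).
      by apply/eqP; rewrite eq_sym -subr_eq0 (mm_dL H) scale0r oppr0.
    - by rewrite /E (twist_primary _ _ (primaryL i)) Eu linearZZ mulr0 scale0r subr0.
    - case: gW => [b0|->//]; last by rewrite /E linear0 scaler0.
      by rewrite /E (twist_primary _ _ (primaryW i)) b0 Eu linearZZ !mulr0 scale0r subr0.
  exists g; split; last by case: gW => [|gW]; [left|right => i n u; apply: gW].
  move=> u; have := allE u; rewrite /E /twist /= => <-.
  by rewrite opprB addrC subrK scalerA mulfV // scale1r.
have [S [sS dS nS [_ TS _]]] := ex_quasi_primary.
have [g [u [Su u0 gu]]] := ex_eigenvector sS dS TS nS.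
have ng : nonzero (E g) by exists u.
have [b0|b0] := eqVneq beta 0; first by exists g => //; left.
(* Now beta is nonzero. If W killed no eigenspace of T, each eigenvalue [e] would produce
   [e - beta], and [r.+1] distinct eigenvalues would occur. *)
apply: contrapT => hno.
have step e : nonzero (E e) -> nonzero (E (e - beta)).
  move=> ne; apply: contrapT => h; apply: hno; exists e => //; right=> i n w Ew.
  apply: contrapT => /eqP Ww; apply: h; exists (W i n w) => //.
  by rewrite /E (twist_primary _ _ (primaryW i)) mulKf // Ew linearZZ scalerBl.
have all_k k : nonzero (E (g - beta * k%:R)).
  elim: k => [|k IH]; first by rewrite mulr0 subr0.
  by rewrite mulrSr mulrDr mulr1 opprD addrA; apply: step.
have [x hx] := choice (fun k : 'I_r.+1 => let: ex_intro2 x Ex x0 := all_k k in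
  ex_intro (fun x => E _ x /\ x != 0) x (conj Ex x0)).
apply: (@twist_eigenvalues (fun k => g - beta * k%:R) x) => [i j|k|k].
- by move/addrI/oppr_inj/(mulfI b0)/eqP; rewrite eqr_nat => /eqP/val_inj.
- by case: (hx k).
- by case: (hx k).
Qed.

Lemma L01_shift_iter e j u : (forall v, L 0 0 v = p *: shift d e v) ->
  L 0 1 (iter j (shift d e) u)
  = iter j (shift d e) (L 0 1 u) + (p * j%:R) *: iter j (shift d e) u.
Proof.
move=> h; elim: j => [|j IH]; first by rewrite mulr0 scale0r addr0.
rewrite iterS (primary_comm_shift _ _ _ (primaryL 0)) IH h linearD linearZZ scale1r.
by rewrite -addrA -scalerDl mulrSr mulrDr mulr1.
Qed.

(** * Independence of the vectors A_i(n) v *)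

Section Dedekind.
Context (w : F) (v : U) (hv : quasi_primary v) (hw : L 0 1 v = w *: v).
Context (I : eqType) (A : I -> nat -> {linear U -> U}) (s : I -> F).
Context (hA : forall i, primary (A i) (s i) 0).

Implicit Types (q : seq I) (c : I -> F).

Definition relation (q : seq I) (c : I -> F) (n : I -> nat) : Prop :=
  \sum_(i <- q) c i *: A i (n i) v = 0.

Lemma L0_mode m i n : (0 < m)%N ->
  L 0 m.+1 (A i n v) = (s i * m.+1%:R - p * n%:R) *: A i (n + m) v.
Proof.
move=> m0; rewrite (primary_comm_L0 _ _ _ (hA i)) hv // linear0 add0r scale0r addr0.
by rewrite addSn /= addnC.
Qed.

Lemma L01_mode i n : L 0 1 (A i n v) = (s i - p * n%:R + w) *: A i n v.
Proof.
rewrite (primary_comm_L0 _ _ _ (hA i)) hw linearZZ scale0r addr0 mulr1 add1n.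
by rewrite -scalerDl addrC.
Qed.

Lemma relation_lin q c c' n (a b : F) : relation q c n -> relation q c' n ->
  relation q (fun i => a * c i + b * c' i) n.
Proof.
rewrite /relation => h h'; under eq_bigr do rewrite scalerDl -!scalerA.
by rewrite big_split /= -!scaler_sumr h h' !scaler0 addr0.
Qed.

Lemma relation_eq q c c' n n' : c =1 c' -> n =1 n' -> relation q c n -> relation q c' n'.
Proof. by move=> hc hn h; rewrite /relation -[RHS]h; apply: eq_bigr => i _; rewrite hc hn. Qed.

(** The common value [b] says that all terms have the same L_0(1)-weight; it makes the factor
    produced by [L 0 m.+1] affine in [s i], with coefficients independent of i. *)
Lemma relation_shift q c n b m : (0 < m)%N -> {in q, forall i, s i - p * (n i)%:R = b} ->
  relation q c n -> relation q (fun i => c i * (m%:R * s i + b)) (fun i => n i + m)%N.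
Proof.
move=> m0 hb /(congr1 (L 0 m.+1)); rewrite linear0 linear_sum => h.
rewrite /relation -[RHS]h; apply: eq_big_seq => i qi.
by rewrite linearZZ L0_mode // scalerA -(hb i qi); congr (_ * _ *: _); rewrite mulrSr; ring.
Qed.

Lemma weight_shift q (n : I -> nat) b m : {in q, forall i, s i - p * (n i)%:R = b} ->
  {in q, forall i, s i - p * (n i + m)%:R = b - p * m%:R}.
Proof. by move=> hb i qi; rewrite -(hb i qi) natrD; ring. Qed.

(* Second difference in k of the multiplier B (m s + B) + k (m s^2 - p B)
   - k^2 s (s + p) of L0_(m - k + 1) L0_(k + 1), for k = 0, 1, 2. *)
Lemma relation_quadratic q c n b m : (2 < m)%N -> {in q, forall i, s i - p * (n i)%:R = b} ->
  relation q c n -> relation q (fun i => c i * (s i * (s i + p))) (fun i => n i + m)%N.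
Proof.
move=> m2 hb h.
have h0 : relation q (fun i => c i * (m%:R * s i + b)) (fun i => n i + m)%N.
  by apply: relation_shift hb h; lia.
have hk k : (0 < k < m)%N -> relation q
    (fun i => c i * (k%:R * s i + b) * ((m%:R - k%:R) * s i + (b - p * k%:R)))
    (fun i => n i + m)%N.
  move=> /andP[k0 km].
  have := relation_shift (m := m - k) _ (weight_shift k hb) (relation_shift k0 hb h).
  rewrite subn_gt0 km => /(_ isT); apply: relation_eq => i; last by rewrite -addnA subnKC // ltnW.
  by rewrite natrB // ltnW.
have := relation_lin (- (b / 2)) 1 h0 (relation_lin 1 (- (1 / 2)) (hk 1 _) (hk 2 _)).
have -> : (0 < 1 < m)%N by lia. have -> : (0 < 2 < m)%N by lia.
move=> /(_ isT isT); apply: relation_eq => // i.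
by field.
Qed.

(** Two relations at the same modes whose multipliers differ by the factor [s i] allow one term to
    be eliminated. The first compares the shifts 3 + 3 and 4 + 2, whose affine factors differ by s +
    p; the second applies [relation_quadratic] twice. *)
Lemma relation_step q c n b :
  {in q, forall i, s i - p * (n i)%:R = b} -> relation q c n ->
  relation q (fun i => c i * (s i * (s i + p) * (s i + p))) (fun i => n i + 6)%N /\
  relation q (fun i => c i * (s i * (s i + p) * (s i + p)) * s i) (fun i => n i + 6)%N.
Proof.
move=> hb h.
have h3 := relation_quadratic (m := 3) isT hb h.
have h4 := relation_quadratic (m := 4) isT hb h.
have h33 := relation_shift (m := 3) isT (weight_shift _ hb) h3.
have h42 := relation_shift (m := 2) isT (weight_shift _ hb) h4.
have hqq := relation_quadratic (m := 3) isT (weight_shift _ hb) h3.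
split; last by apply: relation_eq hqq => i; [ring | rewrite -addnA].
have {}h33 : relation q (fun i => c i * (s i * (s i + p)) * (3 * s i + (b - p * 3)))
  (fun i => n i + 6)%N by apply: relation_eq h33 => // i; rewrite -addnA.
have {}h42 : relation q (fun i => c i * (s i * (s i + p)) * (2 * s i + (b - p * 4)))
  (fun i => n i + 6)%N by apply: relation_eq h42 => // i; rewrite -addnA.
by apply: relation_eq (relation_lin 1 (-1) h33 h42) => // i; ring.
Qed.

(** Induction on the number of terms, eliminating [i0] with [relation_step]. Each round raises all
    modes by 6, whence the required distance to the nonvanishing modes [t i]. *)
Lemma relation_trivial q c n b (t : I -> nat) : uniq q ->
    {in q &, injective s} -> {in q, forall i, s i * (s i + p) != 0} ->
    {in q, forall i, A i (t i) v != 0} -> {in q, forall i, (n i + 6 * size q <= t i)%N} ->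
    {in q, forall i, s i - p * (n i)%:R = b} ->
  relation q c n -> {in q, forall i, c i = 0}.
Proof.
elim: q c n b => [//|i0 q IH] c n b /= /andP[qi0 uq] injs s0 t0 nt hb h.
have qq i : i \in q -> i \in i0 :: q by rewrite inE orbC => ->.
have tail0 : {in q, forall i, c i = 0}.
  have [h1 h2] := relation_step hb h.
  pose m i := s i * (s i + p) * (s i + p).
  have h3 : relation q (fun i => c i * m i * (s i - s i0)) (fun i => n i + 6)%N.
    have := relation_lin (- s i0) 1 h1 h2; rewrite /relation big_cons.
    have -> : - s i0 * (c i0 * (s i0 * (s i0 + p) * (s i0 + p)))
      + 1 * (c i0 * (s i0 * (s i0 + p) * (s i0 + p)) * s i0) = 0 by ring.
    rewrite scale0r add0r => {2}<-; apply: eq_bigr => i _; congr (_ *: _); rewrite /m; ring.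
  move=> i qi; have := IH _ _ (b - p * 6) uq _ _ _ _ _ h3 i qi.
  have -> : (c i * m i * (s i - s i0) = 0) = (c i = 0).
    rewrite propeqE; split=> [/eqP|->]; last by rewrite !mul0r.
    have si := s0 i (qq i qi); move: (si); rewrite mulf_eq0 negb_or => /andP[_ sip].
    rewrite !(mulf_eq0 _ (_ - _)) (mulf_eq0 _ (m i)) (negPf (mulf_neq0 si sip)) orbF subr_eq0.
    case/orP => /eqP // e.
    have ii0 : i = i0 by apply: injs e; [apply: qq|apply: mem_head].
    by rewrite -ii0 qi in qi0.
  apply.
  - by move=> j k qj qk; apply: injs; apply: qq.
  - by move=> j qj; apply: s0; apply: qq.
  - by move=> j qj; apply: t0; apply: qq.
  - by move=> j qj; have := nt j (qq j qj); lia.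
  - by move=> j qj; rewrite (weight_shift _ hb) //; apply: qq.
move=> i; rewrite inE => /orP[/eqP ->|]; last exact: tail0.
move: h; rewrite /relation big_cons big1_seq ?addr0 => [h|j /andP[_ qj]]; last first.
  by rewrite tail0 // scale0r.
have h1 : relation [:: i0] c n by rewrite /relation big_seq1.
have hb1 : {in [:: i0], forall i, s i - p * (n i)%:R = b}.
  by move=> j; rewrite inE => /eqP ->; apply: hb; apply: mem_head.
have nt0 := nt i0 (mem_head _ _).
(* The one remaining term is moved exactly to mode [t i0], where it does not vanish. *)
have := relation_quadratic (m := t i0 - n i0) _ hb1 h1.
rewrite /relation big_seq1 subnKC; last by lia.
have -> : (2 < t i0 - n i0)%N by lia.
move=> /(_ isT)/eqP; rewrite scaler_eq0 (negPf (t0 _ (mem_head _ _))) orbF mulf_eq0.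
by rewrite (negPf (s0 _ (mem_head _ _))) orbF => /eqP.
Qed.
End Dedekind.

(** * Finiteness of weights and of the set of i acting nontrivially *)

Section FiniteSets.
Local Open Scope classical_set_scope.
Local Open Scope ring_scope.

Lemma infinite_set_ord (T : choiceType) (A : set T) n :
  infinite_set A -> exists x : 'I_n.+1 -> T, injective x /\ forall k, A (x k).
Proof.
move=> /(@infinite_set_fset _ _ n.+1) [B BA nB].
have /fset0Pn [x0 _] : B != fset0 by rewrite -cardfs_gt0; apply: leq_trans nB.
have lt_size (k : 'I_n.+1) : (k < size (enum_fset B))%N.
  exact: leq_trans (ltn_ord k) nB.
exists (fun k => nth x0 B k); split=> [i j /eqP|k]; last by apply: BA; apply: mem_nth.
by rewrite nth_uniq ?fset_uniq // => /eqP/val_inj.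
Qed.

Section Weights.
Context (e : F) (L00 : forall u, L 0 0 u = p *: shift d e u).

(** Each factor D - e raises the L_0(1)-weight by p, so a relation over C[D] splits into its
    homogeneous parts, and D - e is injective. *)
Lemma weight_space_dim_le w : dim_le r (fun u => L 0 1 u = w *: u).
Proof.
move=> x hx; have [m [c [[k ck] rel]]] := mm_rank H e x.
exists (fun k => c k m); first by exists k.
pose z j := \sum_k c k j *: x k.
have hz j : L 0 1 (z j) = w *: z j.
  rewrite linear_sum scaler_sumr; apply: eq_bigr => i _.
  by rewrite linearZZ hx !scalerA mulrC.
apply: (shift_iter_injective (e := e) (n := m)).
apply: (@eigenvectors_independent _ _ _ (index_enum 'I_m.+1) (fun j => w + p * j%:R)
  (fun j => iter j (shift d e) (z j)) (L 0 1) _ _ _ rel ord_max).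
- exact: index_enum_uniq.
- by move=> i j _ _ /addrI/(mulfI p0)/eqP; rewrite eqr_nat => /eqP/val_inj.
- move=> j _; rewrite (L01_shift_iter) // hz scalerDl; congr (_ + _).
  exact: iter_scale.
- by rewrite mem_index_enum.
Qed.
End Weights.

(** By [top_relation] at mode 1, L_0(1) kills the leading combination of a relation; its terms have
    distinct weights, so any term with nonzero coefficient has weight 0. *)
Lemma quasi_primary_weights (h : 'I_r.+1 -> F) (x : 'I_r.+1 -> U) : injective h ->
  (forall k, [/\ x k != 0, quasi_primary (x k) & L 0 1 (x k) = h k *: x k]) ->
  exists k, h k = 0.
Proof.
move=> ih hx; have [m [c [[k ck] rel]]] := mm_rank H 0 x.
exists k; pose z j := \sum_i c i j *: x i.
have z0 j n : (1 < n)%N -> L 0 n (z j) = 0.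
  move=> n1; rewrite linear_sum big1 // => i _; have [_ qi _] := hx i.
  by rewrite linearZZ qi // scaler0.
have := top_relation (z := z) (primaryL 0) z0 rel.
rewrite linear_sum => sum0.
have [xk _ hk] := hx k.
suff /eqP : c k m *: L 0 1 (x k) = 0.
  by rewrite hk !scaler_eq0 (negPf ck) (negPf xk) orbF => /eqP.
have := @eigenvectors_independent _ _ _ (index_enum 'I_r.+1) h
  (fun k => c k m *: L 0 1 (x k)) (L 0 1) (index_enum_uniq _) _ _ _ k (mem_index_enum _).
apply=> [i j _ _ /ih //|i _|]; last by rewrite -[RHS]sum0; apply: eq_bigr => i _; rewrite linearZZ.
by have [_ _ hi] := hx i; rewrite hi scalerA linearZZ hi !scalerA; congr (_ *: _); ring.
Qed.

Definition weights : set F :=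
  [set h | exists x, [/\ x != 0, quasi_primary x & L 0 1 x = h *: x]].

Lemma finite_weights : finite_set weights.
Proof.
apply: (sub_finite_set (B := [set 0] `|` (weights `\ 0))).
  by move=> h wh; have [->|h0] := eqVneq h 0; [left | right; split=> //; apply/eqP].
rewrite finite_setU; split; first exact: finite_set1.
apply: contrapT => /(@infinite_set_ord _ _ r) [h [ih hh]].
have /choice [x hx] : forall k, exists x, [/\ x != 0, quasi_primary x & L 0 1 x = h k *: x].
  by move=> k; have [[x hx] _] := hh k; exists x.
have [k hk] := quasi_primary_weights ih hx.
by have [_] := hh k; apply.
Qed.

(** The last nonzero vector [A i t v] is quasi-primary, so its weight h lies in a finite set. For
    fixed h, infinitely many i with large t would give [r.+1] dependent vectors in one weight space,
    against [relation_trivial]. *)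
Lemma finite_nonvanishing e w v (A : nat -> nat -> {linear U -> U}) (s0 : F) :
    (forall u, L 0 0 u = p *: shift d e u) ->
    quasi_primary v -> L 0 1 v = w *: v ->
    (forall i, primary (A i) (i%:R + s0) 0) ->
  finite_set [set i | exists n, A i n v != 0].
Proof.
move=> L00 hv hw hA; pose s i : F := i%:R + s0.
have is_ : injective s by move=> i j /addIr/eqP; rewrite eqr_nat => /eqP.
(* [Q] is the room that [relation_trivial] needs for [r.+1] terms. *)
pose Q := (6 * r.+1)%N.
pose bad (h : F) : set nat := [set i : nat | s i * (s i + p) != 0 /\
  exists t, [/\ A i t v != 0, s i - p * t%:R + w = h & (Q <= t)%N]].
(* The exceptional values of [s i]: those with s (s + p) = 0, and those whose last mode is below
   [Q]. *)
pose E h : set F := [set 0; - p] `|` (fun t : nat => h - w + p * t%:R) @` `I_Q.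
apply: (sub_finite_set (B := \bigcup_(h in weights) (bad h `|` s @^-1` E h))).
  move=> i [n /eqP An].
  have [|t [t0 top]] := primary_top (hA i) (u := v); first by move/(_ n).
  have wt := L01_mode hw hA i t.
  exists (s i - p * t%:R + w).
    exists (A i t v); split=> // m m2; case: m m2 => // m m0.
    rewrite (L0_mode hv hA) // top ?scaler0 //; lia.
  have [sE|s_i0] := eqVneq (s i * (s i + p)) 0.
    right; left; move/eqP: sE; rewrite mulf_eq0 => /orP[/eqP|]; first by left.
    by rewrite addr_eq0 => /eqP; right.
  have [Qt|tQ] := leqP Q t; first by left; split=> //; exists t.
  by right; right; exists t => //=; ring.
apply: bigcup_finite => [|h wh]; first exact: finite_weights.
rewrite finite_setU; split; last first.
  apply: finite_preimage => [x y _ _|]; first exact: is_.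
  rewrite !finite_setU; split; first by split; apply: finite_set1.
  by apply: finite_image; apply: finite_II.
apply: contrapT => /(@infinite_set_ord _ _ r) [i [ii hi]].
have /choice [t ht] : forall k, exists t,
    [/\ A (i k) t v != 0, s (i k) - p * t%:R + w = h & (Q <= t)%N].
  by move=> k; case: (hi k).
(* Lowering every last mode by [Q] puts all the vectors into the space of weight [h + p * Q%:R]. *)
pose n k := (t k - Q)%N.
have nE k : s (i k) - p * (n k)%:R = h - w + p * Q%:R.
  by have [_ <- Qt] := ht k; rewrite natrB //; ring.
have hA' k : primary (A (i k)) (s (i k)) 0 := hA (i k).
have [k|c [k ck] ck0] := @weight_space_dim_le e L00 (h + p * Q%:R) (fun k => A (i k) (n k) v).
  by rewrite (L01_mode hw hA) -[s _ - _]/(s (i k) - _) nE; congr (_ *: _); ring.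
have rel : relation v (fun k => A (i k)) (index_enum 'I_r.+1) c n := ck0.
have : c k = 0.
  apply: (relation_trivial hv hA' (t := t) (b := h - w + p * Q%:R) _ _ _ _ _ _ rel).
  - exact: index_enum_uniq.
  - by move=> a b _ _ /is_/ii.
  - by move=> a _; case: (hi a).
  - by move=> a _; case: (ht a).
  - move=> a _; have [_ _ Qt] := ht a; rewrite /n [index_enum _]unlock -enumT size_enum_ord; lia.
  - by move=> a _; apply: nE.
  - exact: mem_index_enum.
by move/eqP; rewrite (negPf ck).
Qed.

Lemma ex_truncated_vector : exists2 v, v != 0 &
  exists J, forall i n, (J <= i)%N -> L i n v = 0 /\ W i n v = 0.
Proof.
have [S [sS dS nS [S1 _ Sq]]] := ex_quasi_primary.
have [w [v [Sv v0 hw]]] := ex_eigenvector sS dS S1 nS.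
exists v => //; have hv := Sq v Sv.
have [e [L00 hW]] := twist_scalar.
have finL : finite_set [set i | exists n, L i n v != 0].
  by apply: (finite_nonvanishing L00 hv hw) => i; apply: primaryL i.
(* [finite_nonvanishing] asks for the extra term [g] to be 0, that is beta = 0; in the other case W
   acts by zero. *)
have finW : finite_set [set i | exists n, W i n v != 0].
  case: hW => [b0|W0].
    apply: (finite_nonvanishing L00 hv hw (s0 := alpha - p)) => i.
    by have := primaryW i; rewrite b0 mulr0 addrA.
  apply: (sub_finite_set (B := set0)); last exact: finite_set0.
  by move=> i [n]; rewrite W0 eqxx.
have : finite_set ([set i | exists n, L i n v != 0] `|` [set i | exists n, W i n v != 0]).
  by rewrite finite_setU.
move=> /finite_seqP [s hs]; exists (\max_(i <- s) i).+1 => i n Ji.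
have hi : ~ ([set i | exists n, L i n v != 0] `|` [set i | exists n, W i n v != 0]) i.
  rewrite hs /= => si; have := @leq_bigmax_seq _ s xpredT id i si isT.
  by rewrite leqNgt Ji.
split; apply: contrapT => /eqP h; apply: hi; [left|right]; by exists n.
Qed.

End FiniteSets.

(** * The modes of all L_i and W_i, graded together *)

Definition gen (x : nat + nat) : nat -> {linear U -> U} :=
  match x with inl i => L i | inr i => W i end.

Definition gen_weight (x : nat + nat) : F :=
  match x with inl i => i%:R + p | inr i => i%:R + alpha - p end.

Definition gen_twist (x : nat + nat) : F :=
  match x with inl _ => 0 | inr _ => p * beta end.

(* With n + gen_degree x as the degree of gen x n, a bracket of operators of
   degrees a and b has components of degree at least a + b - 1. *)
Definition gen_degree (x : nat + nat) : nat :=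
  match x with inl i => i | inr i => i.+1 end.

Local Notation ann := (annihilated gen gen_degree).

Lemma primary_gen x : primary (gen x) (gen_weight x) (gen_twist x).
Proof. by case: x => i; [exact: primaryL i | exact: primaryW i]. Qed.

Lemma ann_L N i n u : ann N u -> (N <= n + i)%N -> L i n u = 0.
Proof. by move=> h; apply: (h (inl i)). Qed.

Lemma ann_W N i n u : ann N u -> (N <= n + i.+1)%N -> W i n u = 0.
Proof. by move=> h; apply: (h (inr i)). Qed.

Lemma gen_commute N x y m k u : ann N u ->
  (N < m + gen_degree x + (k + gen_degree y))%N ->
  gen x m (gen y k u) = gen y k (gen x m u).
Proof.
move=> h; have LW i j a b : (N < a + i + (b + j.+1))%N -> L i a (W j b u) = W j b (L i a u).
  move=> deg; apply/eqP; rewrite -subr_eq0 (mm_LW H).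
  by rewrite !(ann_W h) ?scaler0 ?addr0 //; lia.
case: x y => i [] j /= deg.
- apply/eqP; rewrite -subr_eq0 (mm_LL H) (ann_L h) ?scaler0 //; lia.
- exact: LW.
- by rewrite LW //; lia.
- exact: mm_WW H _ _ _ _ _.
Qed.

(** Commutators with operators of degree at least [N] again have degree at least [N]. Only L_0(0)
    has degree 0. *)
Lemma gen_stable N x k : (0 < k + gen_degree x)%N -> stable (gen x k) (ann N).
Proof.
move=> deg u h y m hm; rewrite (gen_commute h); last by lia.
by rewrite h // linear0.
Qed.

Lemma ex_annihilated : exists N, nonzero (ann N).
Proof.
have [v v0 [J hJ]] := ex_truncated_vector.
have [NL hL] := choice (fun i => mm_finL H i v).
have [NW hW] := choice (fun i => mm_finW H i v).
exists (\max_(i < J) (NL i + NW i + i).+1)%N; exists v => // -[i|i] n /= hn.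
  have [Ji|iJ] := leqP J i; first by case: (hJ i n Ji).
  apply: hL; have := leq_bigmax (F := fun i : 'I_J => (NL i + NW i + i).+1) (Ordinal iJ).
  by move=> /= h; have := leq_trans h hn; lia.
have [Ji|iJ] := leqP J i; first by case: (hJ i n Ji).
apply: hW; have := leq_bigmax (F := fun i : 'I_J => (NL i + NW i + i).+1) (Ordinal iJ).
by move=> /= h; have := leq_trans h hn; lia.
Qed.

(** * Operators of top degree have a common kernel *)

Section TopDegree.
Context (n : nat) (n2 : (2 <= n)%N) (dimS : dim_le r (ann n.+1)).

Lemma subspace_ann N : subspace (ann N). Proof. exact: annihilated_subspace. Qed.

Lemma L01_gen x k u : ann n.+1 u -> (k + gen_degree x)%N = n ->
  L 0 1 (gen x k u) - gen x k (L 0 1 u) = (gen_weight x - p * k%:R) *: gen x k u.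
Proof.
move=> h deg; rewrite (pr_L0 (primary_gen x)) mulr1 add1n /=.
by rewrite (h x k.+1) ?scaler0 ?addr0 //; lia.
Qed.

Lemma stable_top x k : (k + gen_degree x)%N = n -> stable (gen x k) (ann n.+1).
Proof. by move=> deg; apply: gen_stable; lia. Qed.

(** The factor [gen y i] has degree at least 2, so its commutator with [gen x k] has degree at least
    n + 1 and vanishes on [ann n.+1]. *)
Lemma commutator_top x k (y z : nat + nat) i j (c : F) (S' : U -> Prop) :
    (k + gen_degree x)%N = n -> (0 < j + gen_degree z)%N ->
    (1 < i + gen_degree y)%N -> c != 0 ->
    (forall u, ann n.+1 u -> gen y i (gen z j u) - gen z j (gen y i u) = c *: gen x k u) ->
    subspace S' -> stable (gen x k) S' -> nonzero S' -> (forall u, S' u -> ann n.+1 u) ->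
  exists u, [/\ S' u, u != 0 & gen x k u = 0].
Proof.
move=> deg dz dy2 c0 comm sS' SS' nS' sub; have dy := ltnW dy2.
apply: (ex_ker_commutator (subspace_ann _) dimS (gen_stable dy) (gen_stable dz)
  (stable_top deg) comm _ c0 sS' SS' nS' sub).
by move=> u h; apply: (gen_commute h); lia.
Qed.

(* L_0 of mode 1 acts on the operator gen x k by a scalar; if this scalar
   vanishes, gen x k is a commutator of two operators one of which commutes
   with it on ann n.+1. *)
Lemma ex_ker_top x k (S' : U -> Prop) : (k + gen_degree x)%N = n ->
    subspace S' -> nonzero S' -> (forall u, S' u -> ann n.+1 u) ->
    stable (gen x k) S' -> stable (L 0 1) S' ->
  exists u, [/\ S' u, u != 0 & gen x k u = 0].
Proof.
move=> deg sS' nS' sub Sx S1; have Sk := stable_top deg.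
have [w0|w0] := eqVneq (gen_weight x - p * k%:R) 0; last first.
  apply: (ex_ker_shift sS' (dim_le_sub sub dimS) S1 Sx nS' w0).
  by move=> u S'u; apply: L01_gen (sub _ S'u) deg.
case: k => [|k] in deg Sx Sk w0 *; last first.
  apply: (commutator_top (y := inl 0%N) (z := x) (i := 2) (j := k) (c := p * k.+2%:R) deg) => //=.
  - by lia.
  - by rewrite mulf_neq0 // pnatr_eq0.
  move=> u h; rewrite (pr_L0 (primary_gen x)) (h x (2 + k)%N) ?scaler0 ?addr0; last by lia.
  congr (_ *: _); move/eqP: w0; rewrite subr_eq0 => /eqP ->.
  by rewrite !mulrS; ring.
move: w0; rewrite mulr0 subr0.
case: x => i /= in deg Sx Sk * => w0.
  apply: (commutator_top (x := inl i) (y := inl 1%N) (z := inl i.-1)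
    (i := 1) (j := 0) (c := -1)) => //=.
  - by lia.
  - by rewrite oppr_eq0 oner_eq0.
  move=> u h; rewrite (mm_LL H) /= add1n prednK; last by lia.
  congr (_ *: _); rewrite mulr0 mulr1 subr0 -[LHS](addrK (1 : F)).
  have -> : i.-1%:R + p + 1 = 0 :> F by rewrite -w0 addrAC natr1 prednK //; lia.
  by rewrite add0r.
apply: (commutator_top (x := inr i) (y := inl i) (z := inr 0%N)
  (i := 1) (j := 0) (c := - i%:R)) => //=.
- by lia.
- by rewrite oppr_eq0 pnatr_eq0; lia.
move=> u h; rewrite (mm_LW H) /= !addn0 [W i 1 u](ann_W h); last by lia.
rewrite scaler0 addr0; congr (_ *: _); rewrite mulr0 mulr1 subr0 add0r.
by apply/eqP; rewrite -subr_eq0 opprK addrC addrA w0.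
Qed.

(** Since 2n > n + 1, operators of degree n commute on [ann n.+1]; the kernels found so far
    therefore stay stable, also under L_0(1), and [ex_ker_top] applies again. *)
Lemma ex_common_ker_top (s : seq ((nat + nat) * nat)) :
  nonzero (ann n.+1) -> {in s, forall x, (x.2 + gen_degree x.1)%N = n} ->
  nonzero (fun u => ann n.+1 u /\ {in s, forall x, gen x.1 x.2 u = 0}).
Proof.
move=> nz; elim: s => [|[x k] s IH] hs; first by case: nz => u; exists u.
have hs' : {in s, forall x, (x.2 + gen_degree x.1)%N = n}.
  by move=> y ys; apply: hs; rewrite inE ys orbT.
have deg : (k + gen_degree x)%N = n by apply: (hs (x, k)); apply: mem_head.
pose S' u := ann n.+1 u /\ {in s, forall x, gen x.1 x.2 u = 0}.
have sS' : subspace S'.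
  split.
  + by split=> [|z _]; [exact: subspace0 (subspace_ann _) | exact: linear0].
  + move=> u v [hu su] [hv sv]; split; first exact: (subspaceD (subspace_ann _)).
    by move=> z zs; rewrite linearD su // sv // addr0.
  + move=> c u [hu su]; split; first exact: (subspaceZ (subspace_ann _)).
    by move=> z zs; rewrite linearZZ su // scaler0.
have Sx : stable (gen x k) S'.
  move=> u [h hu]; split; first exact: stable_top deg _ h.
  move=> [z i] zs /=; have /= dz := hs' _ zs; rewrite (gen_commute h); last by lia.
  by rewrite (hu _ zs) linear0.
have S1 : stable (L 0 1) S'.
  move=> u [h hu]; split; first exact: (@gen_stable n.+1 (inl 0) 1 isT u h).
  move=> [z i] zs /=; have /= dz := hs' _ zs; have /eqP := L01_gen h dz.
  by rewrite (hu _ zs) linear0 scaler0 sub0r oppr_eq0 => /eqP.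
have [u [[h hu] u0 xu]] := ex_ker_top deg sS' (IH hs') (fun u hu => hu.1) Sx S1.
by exists u => //; split=> // z; rewrite inE => /orP[/eqP -> //|]; exact: hu.
Qed.
End TopDegree.

Lemma ex_low_degree : exists S, [/\ subspace S, dim_le r S, nonzero S &
  (forall x k, (0 < k + gen_degree x)%N -> stable (gen x k) S) /\ forall u, S u -> ann 2 u].
Proof.
have [N hN] := ex_annihilated.
have [|n [n0 nz dimn]] := ex_min_annihilated primary_gen _ hN.
  by move=> u h; apply: (L0_kernel) => m; apply: ann_L h _.
exists (ann n.+1); split=> //; first exact: annihilated_subspace.
split; first by move=> x k; apply: gen_stable.
suff n1 : (n <= 1)%N by move=> u h x k h2; apply: h; apply: leq_trans h2.
rewrite leqNgt; apply/negP => n2.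
(* All operators of degree exactly n; a common kernel vector in [ann n.+1] lies in [ann n], which is
   zero. *)
pose s := [seq (inl i, (n - i)%N) | i <- iota 0 n.+1] ++ [seq (inr i, (n - i.+1)%N) | i <- iota 0 n]
  : seq ((nat + nat) * nat).
have [|u [h hu] u0] := @ex_common_ker_top n n2 dimn s nz.
  move=> [x k]; rewrite mem_cat => /orP[] /mapP [j]; rewrite mem_iota => hj [-> ->] /=; lia.
move/eqP: u0; apply; apply: n0 => x k; rewrite leq_eqVlt => /orP[/eqP dx|]; last exact: h.
apply: (hu (x, k)); rewrite mem_cat; case: x dx => i dx; rewrite /= in dx; apply/orP; [left|right].
  apply/mapP; exists i; first by rewrite mem_iota; lia.
  by congr (_, _); lia.
apply/mapP; exists i; first by rewrite mem_iota; lia.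
by congr (_, _); lia.
Qed.

(** * Vectors obeying the formulas for the generator of V_{a,b,c,d}, with [e] for d *)

Definition highest_weight_vector (a b c e : F) (v : U) : Prop :=
  [/\ forall n, L 0 n v =
        (match n with 0%N => p *: (d v + b *: v) | 1%N => (p * a) *: v | _ => 0 end),
      forall n, L 1 n v = (if n is 0%N then c *: v else 0),
      forall i n, (2 <= i)%N -> L i n v = 0,
      forall n, W 0 n v = (if n is 0%N then e *: v else 0) &
      forall i n, (1 <= i)%N -> W i n v = 0].

(** If [x] shifts L_0(1)-weights by a nonzero amount, the eigenvalue 0 is available; [Q] records the
    exceptional case where the eigenvalue is arbitrary. *)
Lemma ex_eigenspace S (x : {linear U -> U}) (Q : Prop) : subspace S -> dim_le r S ->
    nonzero S -> stable x S -> stable (L 0 1) S ->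
    (Q \/ exists2 t, t != 0 & forall u, S u -> L 0 1 (x u) - x (L 0 1 u) = t *: x u) ->
  exists c, (c = 0 \/ Q) /\ nonzero (fun u => S u /\ x u = c *: u).
Proof.
move=> sS dS nS Sx S1 [q|[t t0 xt]].
  by have [c [u [Su u0 xu]]] := ex_eigenvector sS dS Sx nS; exists c; split; [right | exists u].
have [u [Su u0 xu]] := ex_ker_shift sS dS S1 Sx nS t0 xt.
by exists 0; split; [left | exists u => //; rewrite scale0r].
Qed.

(** L_0(1) shifts L_1(0) by 1 + p and W_0(0) by alpha - p, which yields the conditions on [c] and
    [e]. Each eigenspace taken is stable under L_0(1), because either the shift or the eigenvalue is
    0; so L_0(1) is diagonalised last. *)
Lemma ex_highest_weight_vector : exists a b c e v, [/\ v != 0, c = 0 \/ p = -1,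
  e = 0 \/ (alpha = p /\ beta = 0) & highest_weight_vector a b c e v].
Proof.
have [g [L00 hW]] := twist_scalar.
have [S [sS dS nS [SS S2]]] := ex_low_degree.
have S_E : stable (L 0 1) S := SS (inl 0%N) 1%N isT.
have S_F : stable (L 1 0) S := SS (inl 1%N) 0%N isT.
have S_G : stable (W 0 0) S := SS (inr 0%N) 0%N isT.
have EF u : S u -> L 0 1 (L 1 0 u) - L 1 0 (L 0 1 u) = (1 + p) *: L 1 0 u.
  by move=> _; rewrite (mm_LL H) mulr1 mulr0 subr0.
have EG u : S u -> L 0 1 (W 0 0 u) - W 0 0 (L 0 1 u) = (alpha - p) *: W 0 0 u.
  move=> Su; rewrite (mm_LW H) (@ann_W 2 0 1 u (S2 u Su)) //.
  by rewrite scaler0 addr0 mulr1 mulr0 subr0 add0r.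
have FG u : S u -> L 1 0 (W 0 0 u) = W 0 0 (L 1 0 u).
  move=> Su; apply/eqP; rewrite -subr_eq0 (mm_LW H) !mulr0 subrr scale0r add0r.
  by rewrite (ann_W (S2 u Su)) ?scaler0.
have [|e [he [u Su u0]]] := @ex_eigenspace S (W 0 0) (alpha = p /\ beta = 0) sS dS nS S_G S_E.
  have [ap|ap] := eqVneq alpha p; last first.
    by right; exists (alpha - p) => //; rewrite subr_eq0.
  case: hW => [|W0]; first by left.
  (* W vanishes here, so any nonzero shift will do. *)
  by right; exists 1; rewrite ?oner_eq0 // => u Su; rewrite !W0 linear0 subrr scaler0.
pose S1 v := S v /\ W 0 0 v = e *: v.
have sS1 : subspace S1 by apply: subspace_ker.
have dS1 : dim_le r S1 by apply: dim_le_sub dS => v [].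
have nS1 : nonzero S1 by exists u.
have S1_F : stable (L 1 0) S1.
  by move=> v [Sv hv]; split; [exact: S_F | rewrite -FG // hv linearZZ].
have S1_E : stable (L 0 1) S1.
  move=> v [Sv hv]; split; first exact: S_E.
  have := EG v Sv; rewrite hv linearZZ => /eqP; rewrite subr_eq addrC -subr_eq => /eqP <-.
  by case: he => [->|[-> _]]; rewrite ?subrr ?scale0r ?scaler0 ?subr0.
have [|c [hc [w S1w w0]]] := @ex_eigenspace S1 (L 1 0) (p = -1) sS1 dS1 nS1 S1_F S1_E.
  have [p1|p1] := eqVneq (1 + p) 0; last by right; exists (1 + p) => // v [Sv _]; exact: EF.
  by left; apply/eqP; rewrite -addr_eq0 addrC p1.
pose S3 v := S1 v /\ L 1 0 v = c *: v.
have sS3 : subspace S3 by apply: subspace_ker.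
have dS3 : dim_le r S3 by apply: dim_le_sub dS1 => v [].
have nS3 : nonzero S3 by exists w.
have S3_E : stable (L 0 1) S3.
  move=> v [S1v hv]; split; first exact: S1_E.
  have := EF v S1v.1; rewrite hv linearZZ => /eqP; rewrite subr_eq addrC -subr_eq => /eqP <-.
  by case: hc => [->|->]; rewrite ?subrr ?scale0r ?scaler0 ?subr0.
have [a [v [[[Sv hG] hF] v0 hE]]] := ex_eigenvector sS3 dS3 S3_E nS3.
have h2 := S2 v Sv.
exists (p^-1 * a), (- g), c, e, v; split=> //; split.
- case=> [|[|n]]; first by rewrite L00 /= scaleNr.
    by rewrite mulVKf.
  by apply: ann_L h2 _; rewrite addn0.
- by case=> [//|n]; apply: ann_L h2 _; rewrite addn1.
- by move=> i n i2; apply: ann_L h2 _; apply: leq_trans i2 (leq_addl _ _).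
- by case=> [//|n]; apply: ann_W h2 _; rewrite addn1.
- by move=> i n i1; apply: ann_W h2 _; apply: leq_trans (leq_addl _ _).
Qed.

End ModeModules.

(** * The modes of a conformal module *)

(** An alias on which V carries its structure of vector space over the constants, next to that of
    C[D]-module. *)
Definition const_mod (F : fieldType) (V : lmodType {poly F}) : Type := V.

Section ConstMod.
Context (F : fieldType) (V : lmodType {poly F}).

HB.instance Definition _ := GRing.Zmodule.on (const_mod V).

Fact const_scaleA (a b : F) (v : const_mod V) : a%:P *: (b%:P *: (v : V)) = (a * b)%:P *: (v : V).
Proof. by rewrite scalerA polyCM. Qed.

Fact const_scale1 (v : const_mod V) : (1 : F)%:P *: (v : V) = v.
Proof. exact: scale1r. Qed.

Fact const_scaleDr (a : F) :
  {morph (fun v : const_mod V => a%:P *: (v : V) : const_mod V) : u v / u + v}.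
Proof. by move=> u v; apply: scalerDr. Qed.

Fact const_scaleDl (v : const_mod V) :
  {morph (fun a : F => a%:P *: (v : V) : const_mod V) : a b / a + b}.
Proof. by move=> a b; rewrite polyCD scalerDl. Qed.

HB.instance Definition _ := GRing.Zmodule_isLmodule.Build F (const_mod V)
  const_scaleA const_scale1 const_scaleDr const_scaleDl.

Lemma const_scaleE (a : F) (v : const_mod V) : a *: v = a%:P *: (v : V) :> V.
Proof. by []. Qed.

End ConstMod.

Section BCarrier.
Context (F : fieldType).

Lemma B_generated_ind (P : B_carrier F -> Prop) :
    P 0 -> (forall x y, P x -> P y -> P (x + y)) ->
    (forall (c : F) x, P x -> P (c%:P *: x)) -> (forall x, P x -> P ('X *: x)) ->
    (forall i, P (B_L F i)) -> (forall i, P (B_W F i)) -> forall x, P x.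
Proof.
move=> P0 PD Pc PX PL PW; have Pf (f : {poly F}) x : P x -> P (f *: x).
  move=> Px; apply: poly_lmod_ind => // c a a' Pa Pa'.
  by apply: (PD) => //; apply: (Pc).
by apply: B_ind => // f i; apply: (Pf).
Qed.
End BCarrier.

Section Bridge.
Context (F : numClosedFieldType) (alpha beta p : F).
Context (V : conformal_module (frakB alpha beta p)).
Let U := const_mod V.
Let act : B_carrier F -> V -> nat -> V := @cm_action F (frakB alpha beta p) V.
Let act_product : lambda_product act := @cm_product F _ V.
Let act_jacobi a b v : jacobi (B_bracket alpha beta p) act a b v := @cm_jacobi F _ V a b v.

Definition mode (a : B_carrier F) (n : nat) (v : U) : U := act a v n *+ n`!.

Fact mode_linear a n : linear (mode a n).
Proof.
move=> c u v; rewrite /mode const_scaleE (lp_linr act_product) mulrnDl.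
by rewrite scalerMnr.
Qed.

HB.instance Definition _ a n := GRing.isLinear.Build F U U *:%R (mode a n) (mode_linear a n).

Definition mulX (v : U) : U := 'X *: (v : V).

Fact mulX_linear : linear mulX.
Proof. by move=> c u v; rewrite /mulX !const_scaleE scalerDr !scalerA mulrC. Qed.

HB.instance Definition _ := GRing.isLinear.Build F U U *:%R mulX mulX_linear.

Lemma mode_eq0 a n v : (mode a n v = 0) <-> (act a v n = 0).
Proof.
split=> [|h]; last by rewrite /mode h mul0rn.
have n0 : n`!%:R != 0 :> F by rewrite pnatr_eq0 -lt0n fact_gt0.
rewrite /mode => h; rewrite -[LHS]scale1r -[1]/(1%:P) -(mulVf n0) polyCM -scalerA.
by rewrite -[n`!%:R]/(1 *+ n`!) polyCMn scaler_nat h scaler0.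
Qed.

Lemma mode_dl a n v : mode ('X *: a) n v = - (n%:R *: mode a n.-1 v).
Proof.
rewrite /mode (lp_dl act_product); case: n => [|n] /=.
  by rewrite oppr0 mul0rn scale0r oppr0.
by rewrite factS mulnC mulrnA mulNrn scaler_nat mulNrn.
Qed.

Lemma mode_dr a n v : mulX (mode a n v) - mode a n (mulX v) = - (n%:R *: mode a n.-1 v).
Proof.
rewrite /mulX /mode (lp_dr act_product) mulrnDl opprD scalerMnr addrA subrr add0r.
case: n => [|n] /=; first by rewrite mul0rn scale0r.
by rewrite factS mulnC mulrnA scaler_nat.
Qed.

Lemma mode_addl a b n v : mode (a + b) n v = mode a n v + mode b n v.
Proof. by rewrite /mode (lpDl act_product) mulrnDl. Qed.

Lemma mode_scalel (c : F) a n v : mode (c%:P *: a) n v = c *: mode a n v.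
Proof. by rewrite /mode (lpZl act_product) const_scaleE scalerMnr. Qed.

(** Multiplying the coefficient identity by m! n! and absorbing (m - k + n)! into the mode turns the
    binomial into [m ^_ k]. *)
Lemma mode_jacobi a b m n v :
  mode a m (mode b n v) - mode b n (mode a m v)
  = \sum_(k < m.+1) mode (B_bracket alpha beta p a b k) (m - k + n)%N v *+ (m ^_ k).
Proof.
have -> : mode a m (mode b n v) - mode b n (mode a m v)
    = (act a (act b v n) m - act b (act a v m) n) *+ (m`! * n`!).
  have actMn x w k j : act x (w *+ j) k = act x w k *+ j.
    by elim: j => [|j IH]; rewrite ?mulr0n ?(lp0r act_product) // !mulrS (lpDr act_product) IH.
  by rewrite /mode !actMn -!mulrnA mulrnBl [(n`! * m`!)%N]mulnC.
rewrite act_jacobi -sumrMnl; apply: eq_bigr => k _.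
rewrite /mode -!mulrnA; congr (_ *+ _).
have km : (k <= m)%N by rewrite -ltnS.
have := bin_fact (leq_addl (m - k) n); rewrite addnK => <-.
by rewrite -(ffact_fact km); lia.
Qed.

Lemma mode_affine a b c (u w z : F) m n v :
    (forall k, B_bracket alpha beta p a b k = affine_coef u w z k *: c) ->
  mode a m (mode b n v) - mode b n (mode a m v)
  = (m%:R * w - (m + n)%:R * u) *: mode c (m + n).-1 v + z *: mode c (m + n)%N v.
Proof.
move=> hbr; rewrite mode_jacobi big_ord_recl /= hbr subn0 ffactn0 mulr1n /=.
rewrite scalerDl -scalerA mode_addl !mode_scalel mode_dl.
have -> : \sum_(i < m) mode (B_bracket alpha beta p a b (bump 0 i)) (m - bump 0 i + n) v
    *+ m ^_ (bump 0 i) = (m%:R * w) *: mode c (m + n).-1 v.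
  case: m => [|m]; first by rewrite big_ord0 mul0r scale0r.
  rewrite big_ord_recl big1 => [|i _]; last first.
    by rewrite hbr /bump /= scale0r /mode (lp0l act_product) !mul0rn.
  by rewrite addr0 hbr /= mode_scalel subn1 /= ffactn1 -scaler_nat scalerA.
by rewrite scalerN scalerA addrAC scalerBl [X in _ = X + _]addrC [u * _]mulrC.
Qed.

Lemma act_closed (T : V -> Prop) v : T 0 -> (forall u w, T u -> T w -> T (u + w)) ->
    (forall (c : F) u, T u -> T (c%:P *: u)) ->
    (forall i n, T (act (B_L F i) v n)) -> (forall i n, T (act (B_W F i) v n)) ->
  forall x n, T (act x v n).
Proof.
move=> T0 TD Tc TL TW; apply: B_generated_ind => // [n|x y Tx Ty n|c x Tx n|x Tx n].
- by rewrite (lp0l act_product).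
- by rewrite (lpDl act_product); apply: TD.
- by rewrite (lpZl act_product); apply: (Tc).
rewrite (lp_dl act_product); case: n => [|n] /=; first by rewrite oppr0.
by rewrite -[act x v n]scale1r -scaleNr -polyCN; apply: (Tc).
Qed.

Lemma mode_finite a u : exists N, forall n, (N <= n)%N -> mode a n u = 0.
Proof. by have [N hN] := lp_fin act_product a u; exists N => n /hN h; apply/mode_eq0. Qed.

Lemma shift_iter_polyE g e (u : U) :
  iter e (shift mulX g) u = (('X - g%:P) ^+ e : {poly F}) *: (u : V).
Proof.
elim: e => [|e IH]; first by rewrite expr0 scale1r.
by rewrite iterS IH exprS -scalerA scalerBl.
Qed.

Lemma polynomial_relation r (g : 'I_r -> V) (x : 'I_r.+1 -> V) :
    (forall v, exists c : 'I_r -> {poly F}, v = \sum_(i < r) c i *: g i) ->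
  exists2 f : 'I_r.+1 -> {poly F}, exists k, f k != 0 & \sum_k f k *: x k = 0.
Proof.
move=> hg; have /choice [C hC] := fun k => hg (x k).
(* The coordinates, with a zero column added to make the matrix square; its determinant is 0, so it
   has a nonzero left kernel vector. *)
pose M : 'M[{poly F}]_(r.+1) :=
  \matrix_(k, j) (if unlift ord0 j is Some j' then C k j' else 0).
have detM : \det M == 0.
  rewrite (expand_det_col M ord0) big1 // => i _.
  by rewrite mxE unlift_none mul0r.
have [f f0 fM] := det0P detM.
exists (fun k => f 0 k).
  by have /rV0Pn [k fk] := f0; exists k.
under eq_bigr do rewrite hC scaler_sumr.
rewrite exchange_big big1 //= => j _.
under eq_bigr do rewrite scalerA.
rewrite -scaler_suml; have /matrixP /(_ 0 (lift ord0 j)) := fM; rewrite !mxE => fj.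
have -> : \sum_i f 0 i * C i j = 0.
  by rewrite -[RHS]fj; apply: eq_bigr => i _; rewrite mxE liftK.
by rewrite scale0r.
Qed.

(** Taylor expansion of the coefficients at [e], with m the largest degree among them. *)
Lemma shifted_relation r (x : 'I_r.+1 -> U) (f : 'I_r.+1 -> {poly F}) (e : F) :
    (exists k, f k != 0) -> \sum_k f k *: (x k : V) = 0 ->
  exists m (c : 'I_r.+1 -> nat -> F), (exists k, c k m != 0) /\
    \sum_(j < m.+1) iter j (shift mulX e) (\sum_k c k j *: x k) = 0.
Proof.
move=> [k0 fk0] rel; pose q k := f k \Po ('X + e%:P).
have fE k : f k = q k \Po ('X - e%:P).
  by rewrite -comp_polyA comp_polyD comp_polyX comp_polyC subrK comp_polyXr.
have q0 k : f k != 0 -> q k != 0.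
  by apply: contraNneq => qk; rewrite fE qk comp_poly0.
have [k1 _ kmax] := @arg_maxnP _ k0 predT (fun k => size (q k)) isT.
have s1 : (0 < size (q k1))%N.
  by apply: leq_trans (kmax k0 isT); rewrite size_poly_gt0 q0.
exists (size (q k1)).-1, (fun k j => (q k)`_j); split.
  by exists k1; rewrite -lead_coefE lead_coef_eq0 -size_poly_gt0.
rewrite prednK // -[RHS]rel.
transitivity (\sum_(j < size (q k1)) \sum_k ((q k)`_j *: ('X - e%:P) ^+ j) *: (x k : V)).
  apply: eq_bigr => j _; rewrite iter_sum; apply: eq_bigr => k _.
  by rewrite iter_scale shift_iter_polyE const_scaleE scalerA mul_polyC.
rewrite exchange_big; apply: eq_bigr => k _ /=; rewrite -scaler_suml.
suff -> : \sum_(i < size (q k1)) (q k)`_i *: ('X - e%:P) ^+ i = f k by [].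
have le_q : (size (q k) <= size (q k1))%N by apply: kmax.
rewrite fE comp_polyE (big_ord_widen _ (fun j => (q k)`_j *: ('X - e%:P) ^+ j) le_q).
rewrite [RHS]big_mkcond.
apply: eq_bigr => j _; case: ltnP => // hj.
by rewrite nth_default // scale0r.
Qed.

Lemma bridge_mode_module : cm_nontrivial V -> cm_finite V -> cm_irreducible V ->
  exists r, mode_module alpha beta p r mulX (fun i n => mode (B_L F i) n)
    (fun i n => mode (B_W F i) n).
Proof.
move=> hnt [r [g hg]] [_ hirr]; exists r; split.
- move=> i j m n u; rewrite (mode_affine (c := B_L F (i + j)) _ _ _ (B_bracketLL _ _ _ i j)).
  by rewrite scale0r addr0 natrD; congr (_ *: _); ring.
- move=> i j m n u; rewrite (mode_affine (c := B_W F (i + j)) _ _ _ (B_bracketLW _ _ _ i j)).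
  by rewrite natrD; congr (_ *: _ + _); ring.
- move=> i j m n u; apply/eqP; rewrite -subr_eq0.
  rewrite (mode_affine (c := 0) (u := 0) (w := 0) (z := 0)) => [|k].
    by rewrite !mulr0 subrr !scale0r addr0.
  by rewrite B_bracketWW scaler0.
- by move=> i n u; apply: mode_dr.
- by move=> i n u; apply: mode_dr.
- by move=> i u; apply: mode_finite.
- by move=> i u; apply: mode_finite.
- move=> e x; have [f f0 rel] := polynomial_relation x hg.
  exact: shifted_relation f0 rel.
- move=> S sS Sd SL SW [u Su u0] v.
  have Sc (c : F) (w : V) : S w -> S (c%:P *: w) by apply: (subspaceZ sS c).
  have unmode a n (w : V) : S (mode a n w) -> S (act a w n).
    have n0 : n`!%:R != 0 :> F by rewrite pnatr_eq0 -lt0n fact_gt0.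
    rewrite /mode => /(Sc (n`!%:R^-1)); rewrite -scaler_nat scalerA -polyC_natr -polyCM mulVf //.
    by rewrite scale1r.
  have [] := hirr S.
  + split=> [|w w'|f w Sw|a w n Sw].
    * exact: (subspace0 sS).
    * exact: (subspaceD sS).
    * have SX a : S a -> S ('X *: a) by apply: Sd.
      have Slin (c : F) a a' : S a -> S a' -> S (c%:P *: a + a').
        by move=> Sa Sa'; apply: (subspaceD sS) Sa'; apply: Sc.
      exact: (poly_lmod_ind Slin SX (subspace0 sS) Sw f).
    * apply: (act_closed (subspace0 sS) (subspaceD sS) Sc) => i k; apply: unmode.
        exact: SL.
      exact: SW.
  + by move=> h; move: u0; rewrite (h u).1 ?eqxx.
  + exact.
- move=> h; apply: hnt => a v n.
  apply: (@act_closed (fun w => w = 0)) => // [u w -> ->|c u ->|i k|i k].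
  + by rewrite addr0.
  + by rewrite scaler0.
  + by apply/mode_eq0; case: (h i k v).
  + by apply/mode_eq0; case: (h i k v).
Qed.
End Bridge.

(** * From a highest weight vector to a module of rank one *)

Section Classification.
Context (F : numClosedFieldType) (alpha beta p : F).
Context (V : conformal_module (frakB alpha beta p)).
Let act : B_carrier F -> V -> nat -> V := @cm_action F (frakB alpha beta p) V.
Let act_product : lambda_product act := @cm_product F _ V.

Let Lm i n : {linear const_mod V -> const_mod V} := @mode F alpha beta p V (B_L F i) n.
Let Wm i n : {linear const_mod V -> const_mod V} := @mode F alpha beta p V (B_W F i) n.
Let dm : {linear const_mod V -> const_mod V} := @mulX F alpha beta p V.

Lemma ker_actL_coef a b c i n : (ker_actL p a b c i)`_n
  = affine_coef (affL p a b c i).1.1 (affL p a b c i).1.2 (affL p a b c i).2 n.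
Proof.
rewrite -coef_affine; congr (nth 0 (polyseq _) n).
by case: i => [|[|i]] /=; rewrite ?polyC0; ring.
Qed.

Lemma ker_actW_coef (e : F) i n :
  (ker_actW e i)`_n = if (i == 0%N) && (n == 0%N) then e%:P else 0.
Proof. by rewrite /ker_actW; case: i => [|i] /=; rewrite ?coef0 ?coefC. Qed.

Section HighestWeight.
Context (a b c e : F) (v : V) (hv : highest_weight_vector p dm Lm Wm a b c e v).

Lemma act_mode01 x n : (n <= 1)%N -> act x v n = mode x n v.
Proof. by case: n => [|[|n]] //= _; rewrite /mode mulr1n. Qed.

Lemma act_L i n : act (B_L F i) v n = (ker_actL p a b c i)`_n *: v.
Proof.
have [h0 h1 h2 _ _] := hv; rewrite ker_actL_coef.
case: i => [|[|i]] /=.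
- have h : mode (B_L F 0) n v = _ := h0 n; case: n h => [|[|n]] h.
  + rewrite act_mode01 // h const_scaleE scalerDr const_scaleE scalerA -polyCM /=.
    by rewrite /mulX scalerA scalerDl.
  + by rewrite act_mode01 // h.
  + by rewrite scale0r; apply/mode_eq0.
- have h : mode (B_L F 1) n v = _ := h1 n; case: n h => [|[|n]] h.
  + by rewrite act_mode01 // h /= polyC0 mul0r add0r.
  + by rewrite scale0r; apply/mode_eq0.
  + by rewrite scale0r; apply/mode_eq0.
- by rewrite affine_coef0 scale0r; apply/mode_eq0; exact: h2.
Qed.

Lemma act_W i n : act (B_W F i) v n = (ker_actW e i)`_n *: v.
Proof.
have [_ _ _ h0 h1] := hv; rewrite ker_actW_coef.
case: i => [|i] /=; last by rewrite scale0r; apply/mode_eq0; exact: h1.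
have h : mode (B_W F 0) n v = _ := h0 n; case: n h => [|n] h.
  by rewrite act_mode01 // h.
by rewrite scale0r; apply/mode_eq0.
Qed.

(** Sesquilinearity in both arguments reduces the intertwining property of [h] to [h *: v] to the
    generators acting on [v]. *)
Lemma V_action_act x (h : {poly F}^o) n :
  V_action p a b c e x h n *: v = act x ((h : {poly F}) *: v) n.
Proof.
have hV := V_product p a b c e.
have h1 : forall n, V_action p a b c e x 1 n *: v = act x v n.
  elim/B_generated_ind: x => {n} [n|x y hx hy n|k x hx n|x hx n|i n|i n].
  - by rewrite (lp0l hV) (lp0l act_product) scale0r.
  - by rewrite (lpDl hV) (lpDl act_product) scalerDl hx hy.
  - by rewrite (lpZl hV) (lpZl act_product) -hx scalerA.
  - rewrite (lp_dl hV) (lp_dl act_product) scaleNr; congr (- _).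
    by case: n => [|n] /=; rewrite ?scale0r ?hx.
  - by rewrite V_actionL act_L.
  - by rewrite V_actionW act_W.
rewrite -[h]mulr1; move: n; apply: (@poly_lmod_ind F {poly F}^o
  (fun h => forall n, V_action p a b c e x h n *: v = act x ((h : {poly F}) *: v) n) 1).
- move=> k f g hf hg n; rewrite (lp_linr hV) [LHS]scalerDl -[X in X + _]scalerA.
  rewrite [X in _ *: X]hf [X in _ + X]hg.
  by rewrite -(lp_linr act_product) scalerA -scalerDl.
- move=> f hf n; rewrite (lp_dr hV) scalerDl -[X in X + _]scalerA hf.
  rewrite -[in RHS]scalerA (lp_dr act_product); congr (_ + _).
  by case: n => [|n] /=; rewrite ?scale0r ?hf.
- by move=> n; rewrite (lp0r hV) !scale0r (lp0r act_product).
- by move=> n; rewrite h1 scale1r.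
Qed.

(** Used with [g = 1] to see that [v] generates V, and with [g = 'X + b%:P] to exclude a = c = e =
    0. *)
Lemma cyclic_submodule (g : {poly F}) : (forall x n, exists f, act x v n = (f * g) *: v) ->
  submodule (fun w => exists f, w = (f * g) *: v).
Proof.
move=> hg; split.
- by exists 0; rewrite mul0r scale0r.
- by move=> _ _ [f ->] [f' ->]; exists (f + f'); rewrite mulrDl scalerDl.
- by move=> f _ [f' ->]; exists (f * f'); rewrite scalerA mulrA.
move=> x _ n [f ->]; move: n.
apply: (@poly_lmod_ind F V (fun w => forall n, exists f, act x w n = (f * g) *: v)).
- move=> k w w' hw hw' n; have [f1 e1] := hw n; have [f2 e2] := hw' n.
  exists (k%:P * f1 + f2); rewrite (lp_linr act_product) e1 e2.
  by rewrite scalerA -scalerDl mulrDl mulrA.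
- move=> w hw n; rewrite (lp_dr act_product).
  have [f1 e1] := hw n; case: n e1 => [|n] e1 /=.
    by exists ('X * f1); rewrite addr0 e1 scalerA mulrA.
  have [f2 e2] := hw n.
  by exists ('X * f1 + f2); rewrite e1 e2 scalerA -scalerDl mulrDl mulrA.
- by move=> n; exists 0; rewrite (lp0r act_product) mul0r scale0r.
- by move=> n; apply: hg.
Qed.
End HighestWeight.

Lemma rank_one_classification : p != 0 ->
  cm_nontrivial V -> cm_finite V -> cm_irreducible V ->
  exists a b c e, [/\ c = 0 \/ p = -1, e = 0 \/ (alpha, beta) = (p, 0),
    [\/ a != 0, c != 0 | e != 0] &
    exists phi : {linear V -> {poly F}^o}, bijective phi /\
      forall x w n, phi (cm_action x w n) = V_action p a b c e x (phi w) n].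
Proof.
move=> p0 hnt hfin hirr; have [r H] := bridge_mode_module hnt hfin hirr.
have [a [b [c [e [v [v0 hc he hv]]]]]] := ex_highest_weight_vector H p0.
have inj0 (f : {poly F}) : f *: (v : V) = 0 -> f = 0.
  move=> fv; apply/eqP; rewrite -lead_coef_eq0 lead_coefE; apply/eqP.
  apply: (@leading_coef_eq0 _ _ _ _ _ _ _ _ _ H p0 0 _ (fun j => f`_j) v v0).
  have [->|f0] := eqVneq f 0.
    by rewrite size_poly0 big1 // => j _; rewrite iter_scale coef0 scale0r.
  rewrite prednK ?size_poly_gt0 // -[RHS]fv.
  transitivity (\sum_(j < size f) (f`_j *: 'X^j) *: (v : V)).
    apply: eq_bigr => j _; rewrite iter_scale shift_iter_polyE polyC0 subr0 const_scaleE scalerA.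
    by rewrite mul_polyC.
  by rewrite -scaler_suml -poly_def coefK.
have nz_v : v <> 0 :> V by apply/eqP.
have sub1 := @cyclic_submodule v 1.
have all_v w : exists f : {poly F}, w = f *: (v : V).
  have [|h|h] := hirr.2 _ (sub1 _).
  - move=> x n; exists (V_action p a b c e x 1 n).
    by rewrite mulr1 (V_action_act hv) scale1r.
  - by case: nz_v; apply/h; exists 1; rewrite mulr1 scale1r.
  - by have [f] := h w; rewrite mulr1; exists f.
have [phi hphi] := choice all_v.
have phiK f : phi (f *: (v : V)) = f.
  apply/eqP; rewrite -subr_eq0; apply/eqP/inj0.
  by rewrite scalerBl -hphi subrr.
have phi_lin : linear (phi : V -> {poly F}^o).
  by move=> k u w; rewrite {1}(hphi u) {1}(hphi w) scalerA -scalerDl phiK.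
pose Phi : {linear V -> {poly F}^o} :=
  HB.pack phi (GRing.isLinear.Build _ _ _ _ phi phi_lin).
exists a, b, c, e; split=> //.
- by case: he => [|[-> ->]]; [left | right].
(* If a = c = e = 0, all of the action on [v] lies in C[D](D + b)v, a nonzero submodule; it misses
   [v], as evaluation at -b shows. *)
- apply: contrapT => h.
  have {h} [a0 c0 e0] : [/\ a = 0, c = 0 & e = 0].
    by split; apply: contrapT => /eqP nz; apply: h; [constructor 1|constructor 2|constructor 3].
  pose g : {poly F} := 'X + b%:P.
  have gv x n : exists f, act x (v : V) n = (f * g) *: (v : V).
    apply: (@act_closed F alpha beta p V (fun w => exists f, w = (f * g) *: (v : V))).
    + by exists 0; rewrite mul0r scale0r.
    + by move=> _ _ [f ->] [f' ->]; exists (f + f'); rewrite mulrDl scalerDl.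
    + by move=> k _ [f' ->]; exists (k%:P * f'); rewrite scalerA mulrA.
    + move=> i m; rewrite -[cm_action _ _ _]/(act (B_L F i) v m) (act_L hv) ker_actL_coef a0 c0.
      case: i => [|[|i]] /=; rewrite ?affine_coef0; try by exists 0; rewrite mul0r.
      case: m => [|[|m]] /=; rewrite ?mulr0 ?polyC0; try by exists 0; rewrite mul0r.
      by exists p%:P; rewrite /g mulrDr polyCM.
    + move=> i m; rewrite -[cm_action _ _ _]/(act (B_W F i) v m) (act_W hv).
      rewrite ker_actW_coef e0 polyC0 if_same.
      by exists 0; rewrite mul0r.
  have sub_g := @cyclic_submodule v g.
  have [h|h] := hirr.2 _ (sub_g gv).
  + have : g = 0 by apply: inj0; apply/h; exists 1; rewrite mul1r.
    by move/eqP; rewrite -size_poly_eq0 size_XaddC.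
  + have [f vf] := h v; have : f * g - 1 = 0.
      by apply: inj0; rewrite scalerBl -vf scale1r subrr.
    move/(congr1 (fun q => q.[- b])); rewrite /g !hornerE addNr mulr0 sub0r => /eqP.
    by rewrite oppr_eq0 oner_eq0.
exists Phi; split.
  by exists (fun f : {poly F}^o => (f : {poly F}) *: (v : V)) => [w|f]; rewrite /= -?hphi ?phiK.
move=> x w n /=; rewrite {1}(hphi w) -[cm_action _ _ _]/(act x (phi w *: v) n).
by rewrite -(V_action_act hv) phiK.
Qed.
End Classification.

Theorem theorem4p7 (R : realType) (alpha beta p : R[i]) (hp0 : p != 0)
    (V : conformal_module (frakB alpha beta p)) :
  cm_nontrivial V -> cm_finite V -> cm_irreducible V ->
  (p <> -1 ->
    ((alpha, beta) <> (p, 0) ->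
      exists a b : R[i], a != 0 /\ cm_isomorphic V (V_ab alpha beta p a b)) /\
    (forall h : (alpha, beta) = (p, 0),
      exists a b d : R[i], (a != 0 \/ d != 0) /\ cm_isomorphic V (V_abd h a b d))) /\
  (forall hp : p = -1,
    ((alpha, beta) <> (-1, 0) ->
      exists a b c : R[i],
        (a != 0 \/ c != 0) /\ cm_isomorphic V (V_abc alpha beta hp a b c)) /\
    (forall h : (alpha, beta) = (-1, 0),
      exists a b c d : R[i],
        [\/ a != 0, c != 0 | d != 0] /\ cm_isomorphic V (V_abcd hp h a b c d))).
Proof.
move=> hnt hfin hirr.
have [a [b [c [e [hc he nz iso]]]]] := rank_one_classification hp0 hnt hfin hirr.
split=> [p1|hp]; split=> [h0|h].
- have c0 : c = 0 by case: hc.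
  have e0 : e = 0 by case: he.
  rewrite c0 e0 eqxx in nz iso; exists a, b; split=> //.
  by case: nz.
- have c0 : c = 0 by case: hc.
  rewrite c0 eqxx in nz iso; exists a, b, e; split=> //.
  by case: nz => // ?; [left | right].
- have e0 : e = 0 by case: he => // h; rewrite hp in h.
  rewrite e0 eqxx in nz iso; exists a, b, c; split=> //.
  by case: nz => // ?; [left | right].
- by exists a, b, c, e; split.
Qed.
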